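(* Let $w\in W_\infty$. If $w\leq w_{\rho_k}$ in the weak Bruhat order for some $k>0$, then the type $C$ double Schubert polynomial $\mathfrak{C}_w(X,Y)$ is stable; that is, for every $m$ with $w\in W_m$ and every $n>m$, $$\mathfrak{C}_{i(w)}(X_n,Y_n)\big|_{x_{m+1}=\cdots=x_n=y_{m+1}=\cdots=y_n=0}=\mathfrak{C}_w(X_m,Y_m),$$ where $i=i_{m,n}\colon W_m\hookrightarrow W_n$ is the embedding via the first $m$ components.
   Context: Weyl groups. $W_n$ is the hyperoctahedral group of signed permutations of $\{1,\ldots,n\}$ (a bar denotes a negative entry), generated by simple transpositions $s_i$ ($1\leqslant i\leqslant n-1$) and $s_0$; right multiplication by $s_i$ interchanges the entries in positions $i,i+1$, and $(u_1,\ldots,u_n)s_0=(\overline{u}_1,u_2,\ldots,u_n)$; $\ell$ is the length function; $w_0=w_0^{(n)}=(\overline1,\ldots,\overline n)$ is the longest element of $W_n$. For $m<n$, $i_{m,n}\colon W_m\hookrightarrow W_n$ is the embedding via the first $m$ components (fixing $m+1,\ldots,n$), and $W_\infty=\bigcup_nW_n$. Weak Bruhat order: $u\leq v$ if there are generators $s_{a_1},\ldots,s_{a_r}$ with $v=us_{a_1}\cdots s_{a_r}$ and $r=\ell(v)-\ell(u)\geqslant0$. $w_{\rho_k}=[\overline k,\overline{k-1},\ldots,\overline1,k+1,k+2,\ldots]\in W_\infty$. Polynomials, for fixed $n$. $X_n=(x_1,\ldots,x_n)$, $Y_n=(y_1,\ldots,y_n)$. $W_n$ acts on $\mathbb{Z}[Y_n][X_n]$: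 $s_i$ interchanges $x_i,x_{i+1}$, $s_0$ sends $x_1$ to $-x_1$. $\partial_i(f)=(f-s_if)/(x_i-x_{i+1})$ for $1\leqslant i\leqslant n-1$, $\partial_0(f)=(f-s_0f)/(2x_1)$; $\partial'_i=-\partial_i$ for $1\leqslant i\leqslant n-1$, $\partial'_0=\partial_0$; $\partial'_w=\partial'_{a_1}\circ\cdots\circ\partial'_{a_r}$ for a reduced word $w=s_{a_1}\cdots s_{a_r}$. $\widetilde Q_i(X_n)=e_i(X_n)$ (elementary symmetric), $\widetilde Q_{i,j}=\widetilde Q_i\widetilde Q_j+2\sum_{p=1}^j(-1)^p\widetilde Q_{i+p}\widetilde Q_{j-p}$, and for $\lambda=(\lambda_1\geqslant\cdots\geqslant\lambda_r\geqslant0)$ with $r$ even (put $\lambda_r=0$ if necessary), $\widetilde Q_\lambda=\mathrm{Pfaffian}[\widetilde Q_{\lambda_i,\lambda_j}]_{1\leqslant i<j\leqslant r}$. $\mathcal{D}_n$ is the set of strict partitions (distinct nonzero parts, possibly none) with all parts at most $n$; $\lambda'$ is the strict partition whose parts are the complement of those of $\lambda$ in $\{1,\ldots,n\}$; $\widetilde Q(X_n,Y_n)=\sum_{\lambda\in\mathcal{D}_n}\widetilde Q_\lambda(X_n)\widetilde Q_{\lambda'}(Y_n)$; $\Delta(X_n,Y_n)=\prod_{i+j\leqslant n}(x_i-y_j)$. For $w\in W_n$, $\mathfrak{C}_w(X_n,Y_n)=(-1)^{n(n-1)/2}\,\partial'_{w^{-1}w_0}(\Delta(X_n,Y_n)\widetilde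 Q(X_n,Y_n))$. *)

(* Defs.v *)
From HB Require Import structures.
From mathcomp Require Import all_boot all_order all_algebra all_fingroup.
From mathcomp Require Import mpoly.

Set Implicit Arguments.
Unset Strict Implicit.
Unset Printing Implicit Defensive.

Import GRing.Theory.
Local Open Scope ring_scope.

(* Positions and letters 1, ..., n are encoded by 'I_n as 0, ..., n-1.
   The entry of u in position j is the letter sp_abs u j, barred iff sp_sgn u j. *)
Record signed_perm (n : nat) := SignedPerm {
  sp_abs : {perm 'I_n};
  sp_sgn : {ffun 'I_n -> bool}
}.

Definition signed_perm_pair n (u : signed_perm n) := (sp_abs u, sp_sgn u).
Definition pair_signed_perm n (p : {perm 'I_n} * {ffun 'I_n -> bool}) :=
  SignedPerm p.1 p.2.

Lemma signed_perm_pairK n :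
  cancel (@signed_perm_pair n) (@pair_signed_perm n).
Proof. by case. Qed.

HB.instance Definition _ n :=
  Finite.copy (signed_perm n) (can_type (@signed_perm_pairK n)).

Section SignedPermGroup.
Variable n : nat.
Implicit Types u v w : signed_perm n.

Lemma signed_permP u v :
  (forall j, sp_abs u j = sp_abs v j) -> (forall j, sp_sgn u j = sp_sgn v j) ->
  u = v.
Proof.
case: u v => [a s] [b t] /= eab est.
by have -> : a = b by [apply/permP]; have -> : s = t by [apply/ffunP].
Qed.

Definition sp_one := SignedPerm (1%g : {perm 'I_n}) [ffun=> false].

(* The composition u \o v of signed permutations, as bijections of
   {-n, ..., -1, 1, ..., n}; the product of {perm _} is in the other order. *)
Definition sp_mul u v :=
  SignedPerm (sp_abs v * sp_abs u)%g
    [ffun j => sp_sgn v j (+) sp_sgn u (sp_abs v j)].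

Definition sp_inv u :=
  SignedPerm (sp_abs u)^-1%g [ffun j => sp_sgn u ((sp_abs u)^-1%g j)].

Lemma sp_mulA : associative sp_mul.
Proof.
move=> u v w; apply: signed_permP => j; first by rewrite /= !permM.
by rewrite !ffunE permM addbA.
Qed.

Lemma sp_mul1 : left_id sp_one sp_mul.
Proof.
move=> u; apply: signed_permP => j; first by rewrite /= permM perm1.
by rewrite /= !ffunE addbF.
Qed.

Lemma sp_mulV : left_inverse sp_one sp_inv sp_mul.
Proof.
move=> u; apply: signed_permP => j; first by rewrite /= mulgV.
by rewrite !ffunE /= permK addbb.
Qed.

HB.instance Definition _ :=
  Finite_isGroup.Build (signed_perm n) sp_mulA sp_mul1 sp_mulV.

Lemma sp_absM u v j : sp_abs (u * v)%g j = sp_abs u (sp_abs v j).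
Proof. exact: permM. Qed.

Lemma sp_sgnM u v j :
  sp_sgn (u * v)%g j = sp_sgn v j (+) sp_sgn u (sp_abs v j).
Proof. by rewrite ffunE. Qed.

Lemma sp_abs1 j : sp_abs (1%g : signed_perm n) j = j.
Proof. exact: perm1. Qed.

Lemma sp_sgn1 j : sp_sgn (1%g : signed_perm n) j = false.
Proof. by rewrite ffunE. Qed.

Definition ord_prev (i : 'I_n) : 'I_n :=
  Ordinal (leq_ltn_trans (leq_pred i) (ltn_ord i)).

(* For i > 0, s_i exchanges the letters i and i+1, encoded by i-1 and i. *)
Definition simple_refl (i : 'I_n) : signed_perm n :=
  if val i == 0%N then SignedPerm 1%g [ffun j => j == i]
  else SignedPerm (tperm (ord_prev i) i) [ffun=> false].

Definition word (a : seq 'I_n) : signed_perm n := (\prod_(i <- a) simple_refl i)%g.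

Lemma word_cat a b : word (a ++ b) = (word a * word b)%g.
Proof. by rewrite /word big_cat. Qed.

Lemma word1 i : word [:: i] = simple_refl i.
Proof. by rewrite /word big_seq1. Qed.

End SignedPermGroup.

Section Length.
Variable n : nat.
Implicit Types u v w : signed_perm n.

Definition abs_perm (s : {perm 'I_n}) : signed_perm n :=
  SignedPerm s [ffun=> false].

Definition bar1 (k : 'I_n) : signed_perm n := SignedPerm 1%g [ffun j => j == k].

Lemma abs_permM s t : abs_perm (s * t)%g = (abs_perm t * abs_perm s)%g.
Proof.
apply: signed_permP => j; first by [].
by rewrite sp_sgnM !ffunE.
Qed.

Lemma word_tperm (i j : 'I_n) : exists a, word a = abs_perm (tperm i j).
Proof.
wlog lij : i j / (i <= j)%N => [H|].
  case/orP: (leq_total i j) => [|h]; first exact: H.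
  by have [a Ea] := H _ _ h; exists a; rewrite tpermC.
move Ed: (j - i)%N => d; elim: d => [|d IH] in i j lij Ed *.
  have -> : i = j by apply/val_inj/eqP; rewrite eqn_leq lij -subn_eq0 Ed.
  exists [::]; rewrite tperm1 /word big_nil.
  by apply: signed_permP => k; rewrite ?sp_abs1 ?sp_sgn1 /= ?perm1 ?ffunE.
have lt_ij : (i < j)%N by rewrite -subn_gt0 Ed.
have j0 : val j != 0%N by rewrite -lt0n (leq_ltn_trans _ lt_ij).
have Es : simple_refl j = abs_perm (tperm (ord_prev j) j).
  by rewrite /simple_refl (negPf j0).
have le_ip : (i <= ord_prev j)%N by rewrite /= -ltnS prednK // lt0n.
have [a Ea] := IH i (ord_prev j) le_ip ltac:(by rewrite /= -subn1 subnAC Ed subn1).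
have [eip|nip] := eqVneq i (ord_prev j).
  by exists [:: j]; rewrite word1 Es eip.
exists ([:: j] ++ a ++ [:: j]).
rewrite !word_cat word1 Ea Es -!abs_permM; congr abs_perm.
have njp : j != ord_prev j.
  by rewrite -val_eqE /= -{1}(prednK (n := j)) ?lt0n // neq_ltn ltnSn orbT.
have nij : i != j by rewrite -val_eqE neq_ltn lt_ij.
have -> : tperm i j = (tperm i (ord_prev j) ^ tperm (ord_prev j) j)%g.
  by rewrite tpermJ tpermL tpermD // eq_sym.
by rewrite conjgE tpermV mulgA.
Qed.

Lemma word_bar1 (k : 'I_n) : exists a, word a = bar1 k.
Proof.
have n0 : (0 < n)%N by apply: leq_ltn_trans (ltn_ord k).
have [a Ea] := word_tperm (Ordinal n0) k.
exists (a ++ [:: Ordinal n0] ++ a).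
rewrite !word_cat word1 Ea /simple_refl /=.
apply: signed_permP => j; first by rewrite !sp_absM /= !perm1 tpermK.
rewrite !sp_sgnM !ffunE /= !addbF /=.
by rewrite (can2_eq (tpermK _ _) (tpermK _ _)) tpermL.
Qed.

Lemma word_surj w : exists a, word a = w.
Proof.
have [a Ea] : exists a, word a = abs_perm (sp_abs w).
  have [ts -> _] := prod_tpermP (sp_abs w).
  elim: ts => [|t ts [b Eb]].
    exists [::]; rewrite big_nil /word big_nil.
    by apply: signed_permP => k; rewrite ?sp_abs1 ?sp_sgn1 /= ?perm1 ?ffunE.
  have [c Ec] := word_tperm t.1 t.2.
  by exists (b ++ c); rewrite big_cons abs_permM word_cat Eb Ec.
have [b Eb] : exists b, word b = SignedPerm 1%g (sp_sgn w).
  suff H (r : seq 'I_n) : uniq r ->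
      exists b, word b = SignedPerm 1%g [ffun j => (j \in r) && sp_sgn w j].
    have [b Eb] := H _ (enum_uniq 'I_n); exists b; rewrite Eb.
    by apply: signed_permP => //= j; rewrite ffunE mem_enum.
  elim: r => [_|k r IH /= /andP[nkr /IH[b Eb]]].
    exists [::]; rewrite /word big_nil.
    by apply: signed_permP => j; rewrite ?sp_abs1 ?sp_sgn1 ?perm1 ?ffunE.
  have [wk|wk] := boolP (sp_sgn w k); last first.
    exists b; rewrite Eb; apply: signed_permP => //= j.
    by rewrite !ffunE in_cons; case: eqP => // ->; rewrite (negPf wk) !andbF.
  have [c Ec] := word_bar1 k.
  exists (b ++ c); rewrite word_cat Eb Ec.
  apply: signed_permP => j; first by rewrite sp_absM /= !perm1.
  rewrite sp_sgnM !ffunE in_cons perm1.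
  by case: eqP => // ->; rewrite wk (negPf nkr).
exists (a ++ b); rewrite word_cat Ea Eb.
apply: signed_permP => j; first by rewrite sp_absM /= perm1.
by rewrite sp_sgnM /= ffunE addbF.
Qed.

Definition word_of_size w l := [exists a : l.-tuple 'I_n, word a == w].

Lemma word_of_size_ex w : exists l, word_of_size w l.
Proof.
have [a Ea] := word_surj w.
by exists (size a); apply/existsP; exists (in_tuple a); rewrite Ea.
Qed.

Definition sp_length w : nat := ex_minn (word_of_size_ex w).

Definition is_reduced_word w (a : seq 'I_n) :=
  (word a == w) && (size a == sp_length w).

Lemma reduced_word_ex w : exists a, is_reduced_word w a.
Proof.
rewrite /is_reduced_word /sp_length; case: ex_minnP => l /existsP[a /eqP Ea] _.
by exists a; rewrite Ea eqxx size_tuple eqxx.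
Qed.

Definition reduced_word w : seq 'I_n := xchoose (reduced_word_ex w).

Definition weak_le u v : Prop :=
  exists a : seq 'I_n, v = (u * word a)%g /\ (sp_length u + size a)%N = sp_length v.

Definition w0 : signed_perm n := SignedPerm 1%g [ffun=> true].

End Length.

(* [n-bar, ..., 2-bar, 1-bar], an element of W_k. *)
Definition w_rho (k : nat) : signed_perm k :=
  SignedPerm (perm (@rev_ord_inj k)) [ffun=> true].

Section Embed.
Variables (m n : nat) (le_mn : (m <= n)%N).

Definition embed_abs (w : signed_perm m) (j : 'I_n) : 'I_n :=
  if insub (val j) is Some i then widen_ord le_mn (sp_abs w i) else j.

Lemma embed_abs_inj w : injective (embed_abs w).
Proof.
move=> j k; rewrite /embed_abs.
case: insubP => [i _ ei|nj]; case: insubP => [i' _ ei'|nk] //.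
- move=> /(congr1 val) /= /val_inj /perm_inj e; apply: val_inj.
  by rewrite -ei -ei' e.
- by move=> /(congr1 val) /= e; move: nk; rewrite /= -e ltn_ord.
- by move=> /(congr1 val) /= e; move: nj; rewrite /= e ltn_ord.
Qed.

Definition embed (w : signed_perm m) : signed_perm n :=
  SignedPerm (perm (@embed_abs_inj w))
    [ffun j : 'I_n => if insub (val j) is Some i then sp_sgn w i else false].

End Embed.

(* W_oo is the union of the W_n along the embeddings, so u <= v holds in W_oo
   iff it holds in some W_N containing u, v and all the generators involved. *)
Definition weak_le_oo (m k : nat) (u : signed_perm m) (v : signed_perm k) : Prop :=
  exists (N : nat) (le_mN : (m <= N)%N) (le_kN : (k <= N)%N),
    weak_le (embed le_mN u) (embed le_kN v).

Section DividedDifferences.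
Variables (R : comNzRingType) (n : nat).
Implicit Types (f : {mpoly R[n]}).

(* w sends x_j to the variable indexed by the entry w_j, with x_{-i} = - x_i. *)
Definition sp_act (w : signed_perm n) f : {mpoly R[n]} :=
  f \mPo [tuple (-1) ^+ sp_sgn w j *: 'X_(sp_abs w j) | j < n].

Definition dd_den (i : 'I_n) : {mpoly R[n]} :=
  if val i == 0%N then 2%:R * 'X_i else 'X_(ord_prev i) - 'X_i.

Lemma dd_ex (i : 'I_n) f :
  exists g, dd_den i * g == f - sp_act (simple_refl i) f.
Proof.
suff H : exists g, dd_den i * g = f - sp_act (simple_refl i) f.
  by case: H => g <-; exists g.
pose D h := exists g, dd_den i * g = h - sp_act (simple_refl i) h.
have actM h1 h2 : sp_act (simple_refl i) (h1 * h2) =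
    sp_act (simple_refl i) h1 * sp_act (simple_refl i) h2 by exact: rmorphM.
have DM h1 h2 : D h1 -> D h2 -> D (h1 * h2).
  move=> [g1 E1] [g2 E2].
  exists (g1 * h2 + sp_act (simple_refl i) h1 * g2).
  rewrite mulrDr mulrA E1 mulrCA E2 actM mulrBl mulrBr.
  by rewrite addrA subrK.
have D1 : D 1 by exists 0; rewrite mulr0 /sp_act comp_mpoly1 subrr.
have DX k : D 'X_k.
  rewrite /D /sp_act comp_mpolyXU -tnth_nth tnth_mktuple /dd_den /simple_refl.
  case: (val i == 0%N) => /=.
    rewrite perm1 ffunE; have [->|_] := eqVneq k i.
      by exists 1; rewrite mulr1 expr1 scaleN1r opprK mulr_natl mulr2n.
    by exists 0; rewrite mulr0 expr0 scale1r subrr.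
  rewrite ffunE expr0 scale1r; case: tpermP => [->|->|_ _].
  - by exists 1; rewrite mulr1.
  - by exists (-1); rewrite mulrN1 opprB.
  - by exists 0; rewrite mulr0 subrr.
elim/mpolyind: f => [|c m f _ _ [g Eg]].
  by exists 0; rewrite mulr0 /sp_act comp_mpoly0 subrr.
have [h Eh] : D 'X_[m].
  rewrite mpolyXE_id; elim/big_ind: _ => // k _.
  by elim: (m k) => [|e IH]; rewrite ?expr0 // exprS; apply: DM.
exists (c *: h + g); rewrite mulrDr -scalerAr Eh Eg /sp_act.
by rewrite comp_mpolyD comp_mpolyZ scalerBr opprD addrACA.
Qed.

(* The quotient (f - s_i f) / dd_den i; it is unique when R is a domain of
   characteristic different from 2. *)
Definition dd (i : 'I_n) f : {mpoly R[n]} := xchoose (dd_ex i f).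

Lemma ddE (i : 'I_n) f : dd_den i * dd i f = f - sp_act (simple_refl i) f.
Proof. exact/eqP/(xchooseP (dd_ex i f)). Qed.

Definition dd' (i : 'I_n) f : {mpoly R[n]} :=
  if val i == 0%N then dd i f else - dd i f.

(* As the operators dd' i satisfy the braid relations, the choice of the
   reduced word is irrelevant. *)
Definition dd'_sp (w : signed_perm n) f : {mpoly R[n]} :=
  foldr dd' f (reduced_word w).

End DividedDifferences.

Section Pfaffian.
Variables (R : comNzRingType) (r : nat).

Lemma pf_even_subproof (p : 'I_r) : (p.*2 < r.*2)%N.
Proof. by rewrite ltn_double. Qed.
Lemma pf_odd_subproof (p : 'I_r) : (p.*2.+1 < r.*2)%N.
Proof. by rewrite ltn_Sdouble. Qed.

Definition pf_even (p : 'I_r) : 'I_r.*2 := Ordinal (pf_even_subproof p).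
Definition pf_odd (p : 'I_r) : 'I_r.*2 := Ordinal (pf_odd_subproof p).

(* s encodes the perfect matching {s 0, s 1}, {s 2, s 3}, ..., with the pairs
   ordered increasingly and listed by increasing first element. *)
Definition is_matching (s : {perm 'I_r.*2}) : bool :=
  [forall p : 'I_r, (s (pf_even p) < s (pf_odd p))%N] &&
  [forall p : 'I_r, forall q : 'I_r,
    (p < q)%N ==> (s (pf_even p) < s (pf_even q))%N].

(* Only the entries a i j with i < j are used. *)
Definition pfaffian (a : 'I_r.*2 -> 'I_r.*2 -> R) : R :=
  \sum_(s : {perm 'I_r.*2} | is_matching s)
    (-1) ^+ s * \prod_(p < r) a (s (pf_even p)) (s (pf_odd p)).

End Pfaffian.

Section QTilde.
Variables (R : comNzRingType) (n : nat).

Definition Qt1 (i : nat) : {mpoly R[n]} := mesym n R i.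

Definition Qt2 (i j : nat) : {mpoly R[n]} :=
  Qt1 i * Qt1 j +
  2%:R * \sum_(1 <= p < j.+1) (-1) ^+ p * Qt1 (i + p) * Qt1 (j - p).

(* The default value of nth pads la with a zero part when its size is odd. *)
Definition Qt (la : seq nat) : {mpoly R[n]} :=
  @pfaffian {mpoly R[n]} (uphalf (size la))
    (fun i j => Qt2 (nth 0%N la i) (nth 0%N la j)).

End QTilde.

(* The strict partitions with all parts at most n correspond to the sets of
   their parts; the part i+1 is encoded by i : 'I_n. *)
Definition strict_part n (A : {set 'I_n}) : seq nat :=
  rev [seq (val i).+1 | i <- enum A].

Section DoubleSchubert.
Variable n : nat.

(* Z[Y_n][X_n] *)
Definition dpoly := {mpoly {mpoly int[n]}[n]}.

Definition Qt_double : dpoly :=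
  \sum_(A : {set 'I_n})
    Qt {mpoly int[n]} n (strict_part A) * (Qt int n (strict_part (~: A)))%:MP.

Definition Delta : dpoly :=
  \prod_(i < n) \prod_(j < n | (i.+1 + j.+1 <= n)%N) ('X_i - ('X_j)%:MP).

Definition schubertC (w : signed_perm n) : dpoly :=
  (-1) ^+ (n * (n - 1))./2 * dd'_sp (w^-1 * w0 n)%g (Delta * Qt_double).

End DoubleSchubert.

(* The substitution X_i = Y_i = 0 for i > m. *)
Definition trunc_vars (m n : nat) (f : dpoly n) : dpoly m :=
  let z (R : comNzRingType) (i : 'I_n) : {mpoly R[m]} :=
    if insub (val i) is Some j then 'X_j else 0 in
  mmap (fun c : {mpoly int[n]} => (c \mPo [tuple z int i | i < n])%:MP)
       (z {mpoly int[m]}) f.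

(* Main.v *)
From HB Require Import structures.
Require Import Defs.
From mathcomp Require Import all_boot all_order all_algebra all_fingroup.
From mathcomp Require Import mpoly.
From mathcomp Require Import zify ring.

Set Implicit Arguments.
Unset Strict Implicit.
Unset Printing Implicit Defensive.

Import Order.TTheory GRing.Theory Num.Theory.
Local Open Scope ring_scope.

(** Signed permutations below [w_rho k] are shuffles of a sequence
    [-r, ..., -1] with [r+1, ..., m] ([shuffle_desc], [shuffle_weak_le]): this
    property is inherited by smaller elements, and within [W_m] every shuffle
    is reached from [w_rho m] by a chain of shuffles, each obtained from the
    previous one by a right multiplication by a simple reflection that lowers
    the length ([shuffle_up]). One such step replaces the double Schubert
    polynomial by its image under a divided difference ([schubertC_desc]),
    and divided differences commute with the truncation of the variables
    ([trunc_ddp]). It is therefore enough to prove the stability of the single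
    element [w_rho m], and, by induction, from [m + 1] to [m] variables only.

    On the one hand, the polynomial of [w_rho n] is [Qt_double n]
    ([schubertC_rho]): along a chain from [w0] to [w_rho n], the divided
    differences remove one by one the factors of [Delta], and they commute with
    the multiplication by [Qt_double n], which is symmetric in the [x_i].

    On the other hand, with [n = m + 1], the element [w_rho m] is obtained from
    [w_rho n] by multiplication by [s_0], [s_1], ..., [s_m], so that its
    polynomial in [n] variables is the image of [Qt_double n] under the
    corresponding divided differences ([schubertC_embed_rho]). The factorization
    [Q_(n, la) = e_n Q_la], a property of Pfaffians ([Qt_cons_top]), gives
    [Qt_double n = e_n(X) Q + Q e_n(Y)], where [Q] is symmetric in the [x_i] and
    has truncation [Qt_double m] ([Qt_doubleS]). The second term vanishes for
    [y_n = 0]. In the first one, the successive divided differences strip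
    [e_n(X)] of its variables and leave [Q] modulo [x_n] ([trunc_pass_top]).

    That divided differences do not depend on the reduced word is proved along
    the way ([ddp_reduced]): the length is the number of inversions, the braid
    relations are identities between rational functions, and two reduced words
    with different last letters are compared with two words which differ by a
    single braid relation at the end. *)

(** * Length and inversions of signed permutations *)

Section SignedValues.
Variable n : nat.
Implicit Types (u v w : signed_perm n) (i j p q : 'I_n).

(** The entry of [u] in position [p] as a signed integer: the letter encoded by
    [sp_abs u p] is [sp_abs u p + 1], and a bar is a minus sign. *)
Definition sval u p : int := (-1) ^+ sp_sgn u p * (sp_abs u p).+1%:Z.

Lemma sval_sgn u p : sp_sgn u p = (sval u p < 0).
Proof. by rewrite /sval; case: (sp_sgn u p); rewrite ?expr1 ?expr0 ?mul1r ?mulN1r; lia. Qed.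

Lemma sval_abs u p : (sp_abs u p).+1 = absz (sval u p).
Proof. by rewrite /sval; case: (sp_sgn u p); rewrite ?expr1 ?expr0 ?mul1r ?mulN1r; lia. Qed.

Lemma sval_inj u v : sval u =1 sval v -> u = v.
Proof.
move=> e; apply: signed_permP => j; last by rewrite !sval_sgn e.
by apply: val_inj; apply: succn_inj; rewrite /= !sval_abs e.
Qed.

Lemma sval_neq0 u p : sval u p != 0.
Proof. by rewrite /sval; case: (sp_sgn u p); rewrite ?expr1 ?expr0 ?mul1r ?mulN1r; lia. Qed.

Lemma absz_sval_inj u p q : absz (sval u p) = absz (sval u q) -> p = q.
Proof. by rewrite -!sval_abs => -[] /val_inj /perm_inj. Qed.

Lemma sval_le u p : (absz (sval u p) <= n)%N.
Proof. by rewrite -sval_abs. Qed.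

Lemma svalM u v p : sval (u * v)%g p = (-1) ^+ sp_sgn v p * sval u (sp_abs v p).
Proof. by rewrite /sval sp_sgnM sp_absM signr_addb mulrA. Qed.

(** The action of [simple_refl i] on positions, for [i > 0]. *)
Definition sw i : {perm 'I_n} := tperm (ord_prev i) i.

Lemma ord_prev_neq i : val i != 0%N -> ord_prev i != i.
Proof. by rewrite -val_eqE /=; lia. Qed.

Lemma sval_s0 u i p : val i = 0%N ->
  sval (u * simple_refl i)%g p = (-1) ^+ (p == i) * sval u p.
Proof. by move=> i0; rewrite svalM /simple_refl i0 /= perm1 ffunE. Qed.

Lemma sval_si u i p : val i != 0%N ->
  sval (u * simple_refl i)%g p = sval u (sw i p).
Proof. by move=> i0; rewrite svalM /simple_refl (negPf i0) /= ffunE mul1r. Qed.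

Lemma simple_reflK i : (simple_refl i * simple_refl i)%g = 1%g.
Proof.
rewrite /simple_refl; case: eqP => _; apply: signed_permP => j.
- by rewrite sp_absM sp_abs1 /= !perm1.
- by rewrite sp_sgnM sp_sgn1 /= perm1 ffunE addbb.
- by rewrite sp_absM sp_abs1 /= tpermK.
- by rewrite sp_sgnM sp_sgn1 /= !ffunE.
Qed.

Lemma simple_reflV i : (simple_refl i)^-1%g = simple_refl i.
Proof. by apply/eqP; rewrite eq_invg_mul simple_reflK. Qed.

(** [i] is a right descent of [u]; with the simple roots [2 x_1] and
    [x_(i+1) - x_i], the root of [simple_refl i] is made negative by [u]. *)
Definition rdesc i u : bool :=
  if val i == 0%N then sval u i < 0 else sval u i < sval u (ord_prev i).

(** The number [ninv u] of positive roots made negative by [u]: [inv_pair] counts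
    the roots [x_q - x_p] for [p < q], and [inv_sum] the roots [x_p + x_q] for
    [p <= q], where [p = q] gives the long roots. *)
Definition inv_pair u (x : 'I_n * 'I_n) : nat :=
  (x.1 < x.2)%N && (sval u x.2 < sval u x.1)%R.
Definition inv_sum u (x : 'I_n * 'I_n) : nat :=
  (x.1 <= x.2)%N && (sval u x.1 + sval u x.2 < 0)%R.
Definition ninv u : nat := (\sum_x inv_pair u x + \sum_x inv_sum u x)%N.

(** Exchanging two adjacent positions only affects the pair that they form. *)
Lemma sum_inv_pair_si u i : val i != 0%N ->
  (\sum_x inv_pair (u * simple_refl i)%g x + (sval u i < sval u (ord_prev i))%R =
   \sum_x inv_pair u x + ~~ (sval u i < sval u (ord_prev i))%R)%N.
Proof.
move=> i0; have nip := ord_prev_neq i0.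
pose f (x : 'I_n * 'I_n) := (sw i x.1, sw i x.2).
have fK : involutive f by case=> x y; rewrite /f /= !tpermK.
rewrite (reindex_inj (inv_inj fK)).
pose a := (ord_prev i, i); pose b := (i, ord_prev i).
have nab : b != a by rewrite /a /b xpair_eqE negb_and eq_sym nip.
rewrite (bigD1 a) //= (bigD1 b) //= [in RHS](bigD1 a) //= [in RHS](bigD1 b) //=.
set S := (\sum_(x | _) _)%N; set S' := (\sum_(x | _) _)%N.
have -> : S = S'.
  apply: eq_bigr => -[x y] /andP[/= xa xb]; rewrite /inv_pair /f /= !sval_si // !tpermK.
  congr (nat_of_bool (_ && _)).
  move: xa xb; rewrite /a /b !xpair_eqE -!val_eqE /=.
  by rewrite /sw; case: tpermP => [->|->|/eqP + /eqP]; case: tpermP => [->|->|/eqP + /eqP];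
    rewrite -?val_eqE /=; lia.
rewrite /inv_pair /f /= /sw !tpermL !tpermR !sval_si // /sw !tpermL !tpermR /=.
have : sval u i != sval u (ord_prev i).
  by apply: contraNneq nip => e; apply/eqP/esym/(@absz_sval_inj u); rewrite e.
have -> : (i < i.-1)%N = false by lia.
have -> : (i.-1 < i)%N by move: i0 => /=; lia.
by move=> h /=; case: ltgtP h => //=; lia.
Qed.

Lemma sum_inv_sum_si u i : val i != 0%N ->
  (\sum_x inv_sum (u * simple_refl i)%g x = \sum_x inv_sum u x)%N.
Proof.
move=> i0; have nip := ord_prev_neq i0.
(* The symmetric version of the sum counts long roots once and short ones twice. *)
pose F w (x : 'I_n * 'I_n) : bool := (sval w x.1 + sval w x.2 < 0)%R.
have E w : ((\sum_x inv_sum w x) * 2 =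
    \sum_x (F w x : nat) + \sum_(x | x.1 == x.2) (F w x : nat))%N.
  have swapK : involutive (fun x : 'I_n * 'I_n => (x.2, x.1)) by case.
  have H : (\sum_x inv_sum w x = \sum_(x : 'I_n * 'I_n) ((x.2 <= x.1)%N && F w x))%N.
    rewrite (reindex_inj (inv_inj swapK)); apply: eq_bigr => -[x y] _.
    by rewrite /inv_sum /F /= addrC; case: (_ < 0); rewrite ?andbT ?andbF.
  rewrite muln2 -addnn {2}H [X in _ = (_ + X)%N]big_mkcond -!big_split /=.
  apply: eq_bigr => -[x y] _; rewrite /inv_sum /F /= -val_eqE /=.
  by case: (_ < 0) => /=; case: ltngtP.
apply/eqP; rewrite -(eqn_pmul2r (ltn0Sn 1)) !E; apply/eqP.
pose f (x : 'I_n * 'I_n) := (sw i x.1, sw i x.2).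
have fK : involutive f by case=> x y; rewrite /f /= !tpermK.
rewrite (reindex_inj (inv_inj fK)); congr addn.
  by apply: eq_bigr => -[x y] _; rewrite /F /= !sval_si // !tpermK.
rewrite (reindex_inj (inv_inj fK)); apply: eq_big => -[x y] /=.
  by rewrite (inj_eq perm_inj).
by move=> _; rewrite /F /= !sval_si // !tpermK.
Qed.

(** Changing the sign of the first entry exchanges the roots [x_q - x_1] and
    [x_1 + x_q], so that only the root [2 x_1] counts. *)
Lemma sum_inv_s0 u i : val i = 0%N ->
  (ninv (u * simple_refl i)%g + (sval u i < 0)%R = ninv u + ~~ (sval u i < 0)%R)%N.
Proof.
move=> i0; rewrite /ninv -!big_split /=.
rewrite (bigD1 (i, i)) //= [in RHS](bigD1 (i, i)) //=.
set S := (\sum_(x | _) _)%N; set S' := (\sum_(x | _) _)%N.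
have -> : S = S'.
  apply: eq_bigr => -[x y] /=; rewrite xpair_eqE /inv_pair /inv_sum /= !sval_s0 //.
  rewrite negb_and.
  have [->|nx] := eqVneq x i; have [->|ny] := eqVneq y i => //= _.
  - have -> : (i < y)%N by move: i0 ny; rewrite -val_eqE /=; lia.
    have -> : (i <= y)%N by move: i0 => /=; lia.
    rewrite ?expr1 ?expr0 ?mul1r ?mulN1r. lia.
  - have -> : (x < i)%N = false by move: i0 => /=; lia.
    have -> : (x <= i)%N = false by move: i0 nx; rewrite -val_eqE /=; lia.
    by [].
  - by rewrite !mul1r.
rewrite /inv_pair /inv_sum /= !sval_s0 // eqxx ltnn leqnn /=.
by have := sval_neq0 u i; lia.
Qed.

Lemma ninv_mul u i :
  (ninv (u * simple_refl i)%g + rdesc i u = ninv u + ~~ rdesc i u)%N.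
Proof.
rewrite /rdesc; case: eqP => [i0|/eqP i0]; first exact: sum_inv_s0.
by rewrite /ninv sum_inv_sum_si // addnAC sum_inv_pair_si // addnAC.
Qed.

Lemma ninv1 : ninv 1%g = 0%N.
Proof.
rewrite /ninv !big1 // => -[x y] _; rewrite /inv_pair /inv_sum /sval /=.
all: rewrite !ffunE !perm1 /=; lia.
Qed.

Lemma ninv_word (a : seq 'I_n) : (ninv (word a) <= size a)%N.
Proof.
elim/last_ind: a => [|a i IH]; first by rewrite /word big_nil ninv1.
rewrite size_rcons -cats1 word_cat word1.
by have := ninv_mul (word a) i; case: rdesc => /=; lia.
Qed.

(** Without descents, the entries are positive and increasing, so that the entry
    in each position is at least the position; the sums of both being equal, so
    are all the terms. *)
Lemma rdesc_none u : (forall i, ~~ rdesc i u) -> u = 1%g.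
Proof.
move=> nd.
have pos (k : nat) (lt : (k < n)%N) : 0 < sval u (Ordinal lt).
  elim: k lt => [|k IH] lt.
    by have := nd (Ordinal lt); rewrite /rdesc /=; have := sval_neq0 u (Ordinal lt); lia.
  have := nd (Ordinal lt); rewrite /rdesc /=.
  have lt' : (k < n)%N by lia.
  have -> : ord_prev (Ordinal lt) = Ordinal lt' by apply: val_inj.
  by have := IH lt'; lia.
have ge (k : nat) (lt : (k < n)%N) : (k.+1 <= absz (sval u (Ordinal lt)))%N.
  elim: k lt => [|k IH] lt; first by have := pos _ lt; lia.
  have lt' : (k < n)%N by lia.
  have := nd (Ordinal lt); rewrite /rdesc /=.
  have ep : ord_prev (Ordinal lt) = Ordinal lt' by apply: val_inj.
  rewrite ep => h; have := IH lt'; have := pos _ lt; have := pos _ lt'.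
  have : absz (sval u (Ordinal lt)) <> absz (sval u (Ordinal lt')).
    by move=> /absz_sval_inj /(congr1 val) /=; lia.
  by lia.
have le_sum (p : 'I_n) : (p <= sp_abs u p)%N.
  by case: p => k lt; have := ge k lt; rewrite -sval_abs.
have eqs : (\sum_(p < n) sp_abs u p = \sum_(p < n) p)%N.
  by rewrite [RHS](reindex_inj (@perm_inj _ (sp_abs u))).
apply: signed_permP => p; last first.
  by rewrite sp_sgn1 sval_sgn; case: p => k lt; have := pos k lt; lia.
rewrite sp_abs1; apply/eqP; rewrite -val_eqE /=; apply/negPn/negP => ne.
have : (\sum_(p < n) p < \sum_(p < n) sp_abs u p)%N.
  rewrite (bigD1 p) //= [X in (_ < X)%N](bigD1 p) //=.
  rewrite -addSn leq_add //; first by have := le_sum p; lia.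
  by apply: leq_sum => q _; apply: le_sum.
by rewrite eqs ltnn.
Qed.

Lemma ninv_word_ex u : exists a, word a = u /\ size a = ninv u.
Proof.
move Ek: (ninv u) => k; elim: k u Ek => [|k IH] u Ek.
  exists [::]; split=> //; rewrite /word big_nil; apply/esym/rdesc_none => i.
  by apply/negP => di; have := ninv_mul u i; rewrite di Ek /=; lia.
have [[i di]|nd] : (exists i, rdesc i u) \/ (forall i, ~~ rdesc i u).
- have [/existsP|/existsPn] := boolP [exists i, rdesc i u]; first by left.
  by right.
- have [|a [Ea Sa]] := IH (u * simple_refl i)%g.
    by have := ninv_mul u i; rewrite di Ek /=; lia.
  exists (rcons a i); rewrite size_rcons Sa; split=> //.
  by rewrite -cats1 word_cat Ea word1 -mulgA simple_reflK mulg1.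
- by move: Ek; rewrite (rdesc_none nd) ninv1.
Qed.

Lemma sp_length_min u a : word a = u -> (sp_length u <= size a)%N.
Proof.
move=> Ea; rewrite /sp_length; case: ex_minnP => l _; apply.
by apply/existsP; exists (in_tuple a); apply/eqP.
Qed.

Lemma sp_lengthE u : sp_length u = ninv u.
Proof.
apply/eqP; rewrite eqn_leq; apply/andP; split.
  by have [a [Ea <-]] := ninv_word_ex u; apply: sp_length_min.
have [a /andP[/eqP Ea /eqP <-]] := reduced_word_ex u.
by rewrite -{1}Ea ninv_word.
Qed.

Lemma sp_length_mul u i :
  (sp_length (u * simple_refl i)%g + rdesc i u = sp_length u + ~~ rdesc i u)%N.
Proof. by rewrite !sp_lengthE ninv_mul. Qed.

Lemma sp_length_desc u i : rdesc i u ->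
  sp_length u = (sp_length (u * simple_refl i)%g).+1.
Proof. by move=> d; have := sp_length_mul u i; rewrite d /=; lia. Qed.

Lemma rdesc_mul u i : rdesc i (u * simple_refl i)%g = ~~ rdesc i u.
Proof.
have := sp_length_mul u i; have := sp_length_mul (u * simple_refl i)%g i.
by rewrite -mulgA simple_reflK mulg1; do 2!case: rdesc => /=; lia.
Qed.

Lemma word_rev (a : seq 'I_n) : word (rev a) = (word a)^-1%g.
Proof.
elim: a => [|i a IH]; first by rewrite /word !big_nil invg1.
by rewrite rev_cons -cats1 word_cat IH word1 -cat1s word_cat word1 invMg simple_reflV.
Qed.

Lemma sp_lengthV u : sp_length u^-1%g = sp_length u.
Proof.
suff H w : (sp_length w^-1%g <= sp_length w)%N.
  by apply/eqP; rewrite eqn_leq H -{1}(invgK u) H.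
have [a /andP[/eqP Ea /eqP <-]] := reduced_word_ex w.
by rewrite -(size_rev a) sp_length_min // word_rev Ea.
Qed.

Lemma sp_length1 : sp_length (1%g : signed_perm n) = 0%N.
Proof. by rewrite sp_lengthE ninv1. Qed.

Lemma sp_length_word_le u a : (sp_length (u * word a)%g <= sp_length u + size a)%N.
Proof.
have [b /andP[/eqP Eb /eqP Sb]] := reduced_word_ex u.
by rewrite -Sb -size_cat sp_length_min // word_cat Eb.
Qed.

End SignedValues.

(** * The action on polynomials and divided differences *)

Section MpolyMorphisms.
Variables (R : nzRingType) (n : nat) (S : nzRingType).

Lemma mpoly_morph_eq (g h : {rmorphism {mpoly R[n]} -> S}) :
  (forall c, g c%:MP = h c%:MP) -> (forall i, g 'X_i = h 'X_i) -> g =1 h.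
Proof.
move=> gC gX f; elim/mpolyind: f => [|c m f _ _ IH]; first by rewrite !rmorph0.
rewrite !rmorphD IH -mul_mpolyC !rmorphM gC mpolyXE_id !rmorph_prod.
by congr (_ * _ + _); apply: eq_bigr => i _; rewrite !rmorphXn gX.
Qed.

End MpolyMorphisms.

(** Sealed copies of the action of the signed permutations, of the divided
    differences, and of the simple roots [2 x_1] and [x_(i+1) - x_i], which
    conversion does not unfold. *)
HB.lock Definition act (R : comNzRingType) n (w : signed_perm n) (f : {mpoly R[n]}) :
  {mpoly R[n]} := sp_act w f.

HB.lock Definition ddp (R : comNzRingType) n (i : 'I_n) (f : {mpoly R[n]}) :
  {mpoly R[n]} := dd' i f.

HB.lock Definition sroot (R : comNzRingType) n (i : 'I_n) : {mpoly R[n]} :=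
  if val i == 0%N then 2%:R * 'X_i else 'X_i - 'X_(ord_prev i).

Arguments act {R n} w f.
Arguments ddp {R n} i f.
Arguments sroot R {n} i.

Section Action.
Variables (R : comNzRingType) (n : nat).
Implicit Types (f g : {mpoly R[n]}) (u v w : signed_perm n) (i j : 'I_n).

Fact act_additive w : {morph @act R n w : f g / f - g}.
Proof. by move=> f g; rewrite act.unlock /sp_act rmorphB. Qed.
Fact act_multiplicative w : monoid_morphism (@act R n w).
Proof. by rewrite act.unlock; split=> [|f g]; rewrite /sp_act (rmorph1, rmorphM). Qed.

HB.instance Definition _ w :=
  GRing.isAdditive.Build _ _ (@act R n w) (@act_additive w).
HB.instance Definition _ w :=
  GRing.isMonoidMorphism.Build _ _ (@act R n w) (@act_multiplicative w).

Lemma actC w c : act w c%:MP = c%:MP :> {mpoly R[n]}.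
Proof. by rewrite act.unlock; apply: comp_mpolyC. Qed.

Lemma actX w i :
  act w 'X_i = (-1) ^+ sp_sgn w i * 'X_(sp_abs w i) :> {mpoly R[n]}.
Proof.
rewrite act.unlock /sp_act comp_mpolyXU -tnth_nth tnth_mktuple -mul_mpolyC rmorphXn.
by rewrite rmorphN rmorph1.
Qed.

Lemma actM u v f : act (u * v)%g f = act u (act v f).
Proof.
pose h : {rmorphism _ -> _} := (act u \o act v : {mpoly R[n]} -> {mpoly R[n]}).
rewrite -[RHS]/(h f); apply: mpoly_morph_eq => [c|i] /=; first by rewrite !actC.
rewrite !actX rmorphM rmorphXn rmorphN rmorph1 /= actX sp_sgnM sp_absM.
by rewrite signr_addb mulrA.
Qed.

Lemma act1 f : act 1%g f = f.
Proof.
rewrite -[RHS]/(idfun f); apply: mpoly_morph_eq => [c|i] /=; first by rewrite actC.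
by rewrite actX sp_sgn1 sp_abs1 mul1r.
Qed.

Lemma actK i f : act (simple_refl i) (act (simple_refl i) f) = f.
Proof. by rewrite -actM simple_reflK act1. Qed.

Lemma act_s0 i j : val i = 0%N ->
  act (simple_refl i) 'X_j = (-1) ^+ (j == i) * 'X_j :> {mpoly R[n]}.
Proof. by move=> i0; rewrite actX /simple_refl i0 /= perm1 ffunE. Qed.

Lemma act_si i j : val i != 0%N ->
  act (simple_refl i) 'X_j = 'X_(sw i j) :> {mpoly R[n]}.
Proof. by move=> i0; rewrite actX /simple_refl (negPf i0) /= ffunE mul1r. Qed.

Lemma sroot0 i : val i = 0%N -> sroot R i = 2%:R * 'X_i.
Proof. by move=> i0; rewrite sroot.unlock i0 eqxx. Qed.

Lemma srootS i : val i != 0%N -> sroot R i = 'X_i - 'X_(ord_prev i).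
Proof. by move=> i0; rewrite sroot.unlock (negPf i0). Qed.

Lemma ddpE i f : sroot R i * ddp i f = f - act (simple_refl i) f.
Proof.
rewrite act.unlock ddp.unlock sroot.unlock -ddE /dd' /dd_den; case: eqP => // _.
by rewrite mulrN -mulNr opprB.
Qed.

Lemma act_sroot i : act (simple_refl i) (sroot R i) = - sroot R i.
Proof.
have [i0|i0] := eqVneq (val i) 0%N.
  by rewrite sroot0 // rmorphM rmorph_nat /= act_s0 // eqxx mulN1r mulrN.
by rewrite srootS // rmorphB /= !act_si // /sw tpermL tpermR opprB.
Qed.

End Action.

Section LinearForms.
Variables (R : idomainType) (n : nat).
Hypothesis two_neq0 : (2%:R : R) != 0.
Implicit Types (i j : 'I_n).

Lemma mpoly_nat2_neq0 : (2%:R : {mpoly R[n]}) != 0.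
Proof. by rewrite -mpolyC_nat mpolyC_eq0. Qed.

Lemma mpolyX_neq0 i : ('X_i : {mpoly R[n]}) != 0.
Proof.
apply/eqP => /(congr1 (mcoeff U_(i))); rewrite mcoeffX eqxx mcoeff0.
exact/eqP/oner_neq0.
Qed.

Lemma mpolyXB_neq0 i j : i != j -> ('X_i - 'X_j : {mpoly R[n]}) != 0.
Proof.
move=> nij; apply/eqP => /(congr1 (mcoeff U_(i))).
rewrite mcoeffB !mcoeffX eqxx mcoeff0 eq_sym.
have -> : (U_(i) == U_(j))%MM = false.
  apply/negP => /eqP/mnmP/(_ i); rewrite !mnmE eqxx eq_sym (negPf nij).
  by [].
by rewrite subr0; apply/eqP/oner_neq0.
Qed.

Lemma mpolyXD_neq0 i j : ('X_i + 'X_j : {mpoly R[n]}) != 0.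
Proof.
have [->|nij] := eqVneq i j.
  by rewrite -mulr2n -(mulr_natl 'X_j 2) mulf_neq0 ?mpoly_nat2_neq0 ?mpolyX_neq0.
apply/eqP => /(congr1 (mcoeff U_(i))).
rewrite mcoeffD !mcoeffX eqxx mcoeff0 eq_sym.
have -> : (U_(i) == U_(j))%MM = false.
  apply/negP => /eqP/mnmP/(_ i); rewrite !mnmE eqxx eq_sym (negPf nij).
  by [].
by rewrite addr0; apply/eqP/oner_neq0.
Qed.

Lemma sroot_neq0 i : sroot R i != 0.
Proof.
have [i0|i0] := eqVneq (val i) 0%N.
  by rewrite sroot0 // mulf_neq0 ?mpoly_nat2_neq0 ?mpolyX_neq0.
by rewrite srootS // mpolyXB_neq0 // eq_sym ord_prev_neq.
Qed.

End LinearForms.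

Section DividedDifferences.
Variables (R : idomainType) (n : nat).
Hypothesis two_neq0 : (2%:R : R) != 0.
Implicit Types (f g h : {mpoly R[n]}) (i j : 'I_n).

Lemma ddp_unique i f g :
  sroot R i * g = f - act (simple_refl i) f -> ddp i f = g.
Proof. by rewrite -ddpE => /(mulfI (sroot_neq0 two_neq0 i)). Qed.

Lemma ddpD i f g : ddp i (f + g) = ddp i f + ddp i g.
Proof. by apply: ddp_unique; rewrite mulrDr !ddpE rmorphD /=; ring. Qed.

Lemma ddpM_inv i f g : act (simple_refl i) g = g -> ddp i (f * g) = ddp i f * g.
Proof. by move=> sg; apply: ddp_unique; rewrite mulrA ddpE rmorphM /= sg; ring. Qed.

End DividedDifferences.

(** * Braid relations *)

Section BraidIdentities.
Variable F : fieldType.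

Lemma mulf_eq_div (c h a : F) : c != 0 -> c * h = a -> h = a / c.
Proof. by move=> c0 <-; rewrite mulrC mulKf. Qed.

(** In these three identities, [f], [sf], [tf], ... stand for the images of a
    polynomial under the elements of the dihedral group generated by two simple
    reflections [s] and [t], and the other letters for the images of the
    successive divided differences; [L] and [K] are the two sides of the braid
    relation. *)
Lemma braid2_field (a b f sf tf stf h th k sk L K : F) :
  a != 0 -> b != 0 ->
  a * h = f - sf -> a * th = tf - stf -> b * L = h - th ->
  b * k = f - tf -> b * sk = sf - stf -> a * K = k - sk -> L = K.
Proof.
move=> a0 b0 /(mulf_eq_div a0) -> /(mulf_eq_div a0) -> /(mulf_eq_div b0) ->.
move=> /(mulf_eq_div b0) -> /(mulf_eq_div b0) -> /(mulf_eq_div a0) ->.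
by field; rewrite a0 b0.
Qed.

Lemma braid3_field (x y z f sf tf stf tsf stsf h1 th1 sth1 h2 sh2 L
    k1 sk1 tsk1 k2 tk2 K : F) :
  y - x != 0 -> z - y != 0 -> z - x != 0 ->
  (y - x) * h1 = f - sf -> (z - x) * th1 = tf - tsf -> (z - y) * sth1 = stf - stsf ->
  (z - y) * h2 = h1 - th1 -> (z - x) * sh2 = h1 - sth1 -> (y - x) * L = h2 - sh2 ->
  (z - y) * k1 = f - tf -> (z - x) * sk1 = sf - stf -> (y - x) * tsk1 = tsf - stsf ->
  (y - x) * k2 = k1 - sk1 -> (z - x) * tk2 = k1 - tsk1 -> (z - y) * K = k2 - tk2 ->
  L = K.
Proof.
move=> a0 b0 c0 /(mulf_eq_div a0) -> /(mulf_eq_div c0) -> /(mulf_eq_div b0) ->.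
move=> /(mulf_eq_div b0) -> /(mulf_eq_div c0) -> /(mulf_eq_div a0) ->.
move=> /(mulf_eq_div b0) -> /(mulf_eq_div c0) -> /(mulf_eq_div a0) ->.
move=> /(mulf_eq_div a0) -> /(mulf_eq_div c0) -> /(mulf_eq_div b0) ->.
by field; rewrite a0 b0 c0.
Qed.

Lemma braid4_field (x y f sf tf stf tsf stsf tstf ststf
    h1 sh1 tsh1 stsh1 h2 th2 sth2 h3 sh3 L
    k1 tk1 stk1 tstk1 k2 sk2 tsk2 k3 tk3 K : F) :
  2%:R * x != 0 -> 2%:R * y != 0 -> y - x != 0 -> y + x != 0 ->
  (y - x) * h1 = f - tf -> (y + x) * sh1 = sf - stf ->
  (y + x) * tsh1 = tsf - tstf -> (y - x) * stsh1 = stsf - ststf ->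
  2%:R * x * h2 = h1 - sh1 -> 2%:R * y * th2 = h1 - tsh1 ->
  2%:R * y * sth2 = sh1 - stsh1 ->
  (y - x) * h3 = h2 - th2 -> (y + x) * sh3 = h2 - sth2 -> 2%:R * x * L = h3 - sh3 ->
  2%:R * x * k1 = f - sf -> 2%:R * y * tk1 = tf - tsf ->
  2%:R * y * stk1 = stf - stsf -> 2%:R * x * tstk1 = tstf - ststf ->
  (y - x) * k2 = k1 - tk1 -> (y + x) * sk2 = k1 - stk1 -> (y + x) * tsk2 = tk1 - tstk1 ->
  2%:R * x * k3 = k2 - sk2 -> 2%:R * y * tk3 = k2 - tsk2 -> (y - x) * K = k3 - tk3 ->
  L = K.
Proof.
move=> x0 y0 b0 c0.
move=> /(mulf_eq_div b0) -> /(mulf_eq_div c0) -> /(mulf_eq_div c0) -> /(mulf_eq_div b0) ->.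
move=> /(mulf_eq_div x0) -> /(mulf_eq_div y0) -> /(mulf_eq_div y0) ->.
move=> /(mulf_eq_div b0) -> /(mulf_eq_div c0) -> /(mulf_eq_div x0) ->.
move=> /(mulf_eq_div x0) -> /(mulf_eq_div y0) -> /(mulf_eq_div y0) -> /(mulf_eq_div x0) ->.
move=> /(mulf_eq_div b0) -> /(mulf_eq_div c0) -> /(mulf_eq_div c0) ->.
move=> /(mulf_eq_div x0) -> /(mulf_eq_div y0) -> /(mulf_eq_div b0) ->.
move: x0 y0; rewrite !mulf_eq0 !negb_or => /andP[two0 x0] /andP[_ y0].
by field; rewrite b0 c0 two0 x0 y0.
Qed.
End BraidIdentities.

Section GroupBraid.
Variable n : nat.
Implicit Types (i j : 'I_n).

Lemma simple_refl_comm i j : (i.+1 < j)%N ->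
  (simple_refl i * simple_refl j = simple_refl j * simple_refl i)%g.
Proof.
move=> ij; have j0 : val j != 0%N by move=> /=; lia.
have nji : j != i by rewrite -val_eqE /=; lia.
have npji : ord_prev j != i by rewrite -val_eqE /=; lia.
have nippj : ord_prev i != ord_prev j by rewrite -val_eqE /=; lia.
have nipj : ord_prev i != j by rewrite -val_eqE /=; lia.
rewrite -[LHS]mul1g -[RHS]mul1g !mulgA; apply: sval_inj => p.
have [i0|i0] := eqVneq (val i) 0%N.
  rewrite (sval_si _ _ j0) !(sval_s0 _ _ i0) (sval_si _ _ j0) /sw.
  by case: tpermP => [->|->|//]; rewrite (negPf nji) (negPf npji).
have comm : (sw j * sw i = sw i * sw j)%g.
  by rewrite [LHS]conjgC tpermJ /sw !tpermD // -val_eqE /=; lia.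
rewrite (sval_si _ _ j0) (sval_si _ _ i0) (sval_si _ _ i0) (sval_si _ _ j0).
by have /permP/(_ p) := comm; rewrite !permM => ->.
Qed.

Lemma ord_prevS i j : val j = (val i).+1 -> ord_prev j = i.
Proof. by move=> e; apply: val_inj; rewrite /= [nat_of_ord j]e. Qed.

Lemma simple_refl_braid3 i j : val i != 0%N -> val j = (val i).+1 ->
  (simple_refl i * simple_refl j * simple_refl i =
   simple_refl j * simple_refl i * simple_refl j)%g.
Proof.
move=> i0 ij; have j0 : val j != 0%N by rewrite ij.
have ep := ord_prevS ij.
have nipj : ord_prev i != j by rewrite -val_eqE /=; move: ij => /=; lia.
have niip := ord_prev_neq i0.
have nij : i != j by rewrite -val_eqE /=; move: ij => /=; lia.
have comm : (sw i * sw j * sw i = sw j * sw i * sw j)%g.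
  have -> : (sw i * sw j * sw i = sw j ^ sw i)%g by rewrite conjgE /sw tpermV mulgA.
  have -> : (sw j * sw i * sw j = sw i ^ sw j)%g by rewrite conjgE /sw tpermV mulgA.
  by rewrite !tpermJ /sw ep tpermR (tpermD (z := j)) // tpermL tpermD 1?eq_sym // eq_sym.
rewrite -[LHS]mul1g -[RHS]mul1g !mulgA; apply: sval_inj => p.
rewrite !(sval_si _ _ i0, sval_si _ _ j0).
by have /permP/(_ p) := comm; rewrite !permM => ->.
Qed.

Lemma simple_refl_braid4 i j : val i = 0%N -> val j = 1%N ->
  (simple_refl i * simple_refl j * simple_refl i * simple_refl j =
   simple_refl j * simple_refl i * simple_refl j * simple_refl i)%g.
Proof.
move=> i0 j1; have j0 : val j != 0%N by rewrite j1.
have ep : ord_prev j = i by apply: ord_prevS; rewrite i0.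
have nij : i != j by rewrite -val_eqE i0 j1.
rewrite -[LHS]mul1g -[RHS]mul1g !mulgA; apply: sval_inj => p.
rewrite !(sval_s0 _ _ i0, sval_si _ _ j0) /sw ep.
have [->|npi] := eqVneq p i.
  by rewrite !(tpermL, tpermR) eqxx eq_sym (negPf nij) !mul1r.
have [->|npj] := eqVneq p j.
  by rewrite !(tpermL, tpermR) eqxx eq_sym (negPf nij) !mul1r.
have tp : tperm i j p = p by rewrite tpermD // eq_sym.
by rewrite !tp (negPf npi) !mul1r.
Qed.

Lemma act_sroot_far (R : comNzRingType) i j : (i.+1 < j)%N ->
  act (simple_refl i) (sroot R j) = sroot R j /\
  act (simple_refl j) (sroot R i) = sroot R i.
Proof.
move=> ij; have j0 : val j != 0%N by move=> /=; lia.
have nji : j != i by rewrite -val_eqE /=; lia.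
have npji : ord_prev j != i by rewrite -val_eqE /=; lia.
have nippj : ord_prev i != ord_prev j by rewrite -val_eqE /=; lia.
have nipj : ord_prev i != j by rewrite -val_eqE /=; lia.
have [i0|i0] := eqVneq (val i) 0%N.
  rewrite (srootS _ j0) (sroot0 _ i0) rmorphB rmorphM rmorph_nat /= !(act_s0 _ _ i0).
  by rewrite (act_si _ _ j0) /sw tpermD // (negPf nji) (negPf npji) !mul1r.
rewrite (srootS _ j0) (srootS _ i0) !rmorphB /= !act_si //.
by rewrite /sw !tpermD // -val_eqE /=; lia.
Qed.

End GroupBraid.

Section Braid.
Variables (R : idomainType) (n : nat).
Hypothesis two_neq0 : (2%:R : R) != 0.
Implicit Types (f g h : {mpoly R[n]}) (i j : 'I_n).
Local Notation F := {fraction {mpoly R[n]}}.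
Local Notation frac := (@tofrac {mpoly R[n]}).

Lemma act_ddp i f : act (simple_refl i) (ddp i f) = ddp i f.
Proof.
apply: (mulfI (sroot_neq0 two_neq0 i)); apply: oppr_inj.
rewrite -mulNr -{1}act_sroot -rmorphM ddpE rmorphB /= actK opprB.
by [].
Qed.

Lemma frac_inj : injective frac.
Proof. by move=> x y /eqP; rewrite tofrac_eq => /eqP. Qed.

Lemma frac_neq0 p : p != 0 -> frac p != 0.
Proof. by rewrite tofrac_eq0. Qed.

(** The defining equation of a divided difference, transported by [w]. *)
Lemma act_ddpE w i f r : act w (sroot R i) = r ->
  frac r * frac (act w (ddp i f)) = frac (act w f) - frac (act w (act (simple_refl i) f)).
Proof. by move=> <-; rewrite -tofracM -tofracB -!rmorphM ddpE rmorphB. Qed.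

Lemma ddpE_frac i f :
  frac (sroot R i) * frac (ddp i f) = frac f - frac (act (simple_refl i) f).
Proof. by rewrite -tofracM -tofracB ddpE. Qed.

Lemma ddp_comm i j f : (i.+1 < j)%N -> ddp i (ddp j f) = ddp j (ddp i f).
Proof.
move=> ij; have [sij sji] := act_sroot_far R ij.
apply: frac_inj; apply: (braid2_field (frac_neq0 (sroot_neq0 two_neq0 j))
  (frac_neq0 (sroot_neq0 two_neq0 i)) (ddpE_frac j f) (act_ddpE f sij)
  (ddpE_frac i _) (ddpE_frac i f)); last exact: ddpE_frac.
by rewrite (act_ddpE f sji) -!actM (simple_refl_comm ij).
Qed.

Lemma ddp_braid3 i j f : val i != 0%N -> val j = (val i).+1 ->
  ddp i (ddp j (ddp i f)) = ddp j (ddp i (ddp j f)).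
Proof.
move=> i0 ij; have j0 : val j != 0%N by rewrite ij.
have ep := ord_prevS ij.
have nipj : ord_prev i != j by rewrite -val_eqE /=; move: ij => /=; lia.
have niip := ord_prev_neq i0.
have nij : i != j by rewrite -val_eqE /=; move: ij => /=; lia.
pose x : {mpoly R[n]} := 'X_(ord_prev i); pose y : {mpoly R[n]} := 'X_i.
pose z : {mpoly R[n]} := 'X_j.
pose s := simple_refl i; pose t := simple_refl j.
have ri : sroot R i = y - x by rewrite srootS.
have rj : sroot R j = z - y by rewrite srootS // ep.
have [sx sy sz] : [/\ act s x = y, act s y = x & act s z = z].
  by rewrite !(act_si _ _ i0) /sw tpermL tpermR tpermD.
have [tx ty tz] : [/\ act t x = x, act t y = z & act t z = y].
  by rewrite !(act_si _ _ j0) /sw ep tpermL tpermR tpermD // eq_sym.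
have srj : act s (sroot R j) = z - x by rewrite rj rmorphB /= sy sz.
have tri : act t (sroot R i) = z - x by rewrite ri rmorphB /= tx ty.
have stri : act (s * t)%g (sroot R i) = z - y by rewrite actM tri rmorphB /= sx sz.
have tsrj : act (t * s)%g (sroot R j) = y - x by rewrite actM srj rmorphB /= tx tz.
have a0 : frac y - frac x != 0 by rewrite -tofracB frac_neq0 // -ri sroot_neq0.
have b0 : frac z - frac y != 0 by rewrite -tofracB frac_neq0 // -rj sroot_neq0.
have c0 : frac z - frac x != 0.
  by rewrite -tofracB frac_neq0 // mpolyXB_neq0 // eq_sym.
have fE g h k : frac (g - h) * k = (frac g - frac h) * k by rewrite tofracB.
apply: frac_inj; apply: (braid3_field a0 b0 c0
  (f := frac f) (sf := frac (act s f)) (tf := frac (act t f))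
  (stf := frac (act (s * t)%g f)) (tsf := frac (act (t * s)%g f))
  (stsf := frac (act (s * t * s)%g f))
  (h1 := frac (ddp i f)) (th1 := frac (act t (ddp i f)))
  (sth1 := frac (act (s * t)%g (ddp i f)))
  (h2 := frac (ddp j (ddp i f))) (sh2 := frac (act s (ddp j (ddp i f))))
  (k1 := frac (ddp j f)) (sk1 := frac (act s (ddp j f)))
  (tsk1 := frac (act (t * s)%g (ddp j f)))
  (k2 := frac (ddp i (ddp j f))) (tk2 := frac (act t (ddp i (ddp j f))))).
- by rewrite -fE -ri ddpE_frac.
- by rewrite -fE (act_ddpE _ tri) -actM.
- by rewrite -fE (act_ddpE _ stri) -actM.
- by rewrite -fE -rj ddpE_frac.
- by rewrite -fE (act_ddpE _ srj) act_ddp -actM.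
- by rewrite -fE -ri ddpE_frac.
- by rewrite -fE -rj ddpE_frac.
- by rewrite -fE (act_ddpE _ srj) -actM.
- by rewrite -fE (act_ddpE _ tsrj) -actM -simple_refl_braid3.
- by rewrite -fE -ri ddpE_frac.
- by rewrite -fE (act_ddpE _ tri) act_ddp -actM.
- by rewrite -fE -rj ddpE_frac.
Qed.

Lemma ddp_braid4 i j f : val i = 0%N -> val j = 1%N ->
  ddp i (ddp j (ddp i (ddp j f))) = ddp j (ddp i (ddp j (ddp i f))).
Proof.
move=> i0 j1; have j0 : val j != 0%N by rewrite j1.
have ep : ord_prev j = i by apply: ord_prevS; rewrite i0.
have nij : i != j by rewrite -val_eqE i0 j1.
pose x : {mpoly R[n]} := 'X_i; pose y : {mpoly R[n]} := 'X_j.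
pose s := simple_refl i; pose t := simple_refl j.
have ri : sroot R i = 2%:R * x by rewrite sroot0.
have rj : sroot R j = y - x by rewrite srootS // ep.
have [sx sy] : act s x = - x /\ act s y = y.
  by rewrite !(act_s0 _ _ i0) eqxx eq_sym (negPf nij) mulN1r mul1r.
have [tx ty] : act t x = y /\ act t y = x.
  by rewrite !(act_si _ _ j0) /sw ep tpermL tpermR.
have srj : act s (sroot R j) = y + x by rewrite rj rmorphB /= sy sx opprK.
have tri : act t (sroot R i) = 2%:R * y by rewrite ri rmorphM rmorph_nat /= tx.
have stri : act (s * t)%g (sroot R i) = 2%:R * y.
  by rewrite actM tri rmorphM rmorph_nat /= sy.
have tsrj : act (t * s)%g (sroot R j) = y + x.
  by rewrite actM srj rmorphD /= tx ty addrC.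
have stsrj : act (s * t * s)%g (sroot R j) = y - x.
  by rewrite -mulgA actM tsrj rmorphD /= sy sx.
have tstri : act (t * s * t)%g (sroot R i) = 2%:R * x.
  by rewrite -mulgA actM stri rmorphM rmorph_nat /= ty.
have x0 : 2%:R * frac x != 0.
  by rewrite -(rmorph_nat frac) -tofracM frac_neq0 // -ri sroot_neq0.
have y0 : 2%:R * frac y != 0.
  by rewrite -(rmorph_nat frac) -tofracM frac_neq0 // mulf_neq0 ?mpoly_nat2_neq0 ?mpolyX_neq0.
have b0 : frac y - frac x != 0 by rewrite -tofracB frac_neq0 // -rj sroot_neq0.
have c0 : frac y + frac x != 0 by rewrite -tofracD frac_neq0 // mpolyXD_neq0.
have fB g h k : frac (g - h) * k = (frac g - frac h) * k by rewrite tofracB.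
have fD g h k : frac (g + h) * k = (frac g + frac h) * k by rewrite tofracD.
have f2 g k : frac (2%:R * g) * k = 2%:R * frac g * k by rewrite tofracM rmorph_nat.
apply: frac_inj; apply: (braid4_field x0 y0 b0 c0
  (f := frac f) (sf := frac (act s f)) (tf := frac (act t f))
  (stf := frac (act (s * t)%g f)) (tsf := frac (act (t * s)%g f))
  (stsf := frac (act (s * t * s)%g f)) (tstf := frac (act (t * s * t)%g f))
  (ststf := frac (act (s * t * s * t)%g f))
  (h1 := frac (ddp j f)) (sh1 := frac (act s (ddp j f)))
  (tsh1 := frac (act (t * s)%g (ddp j f)))
  (stsh1 := frac (act (s * t * s)%g (ddp j f)))
  (h2 := frac (ddp i (ddp j f))) (th2 := frac (act t (ddp i (ddp j f))))
  (sth2 := frac (act (s * t)%g (ddp i (ddp j f))))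
  (h3 := frac (ddp j (ddp i (ddp j f)))) (sh3 := frac (act s (ddp j (ddp i (ddp j f)))))
  (k1 := frac (ddp i f)) (tk1 := frac (act t (ddp i f)))
  (stk1 := frac (act (s * t)%g (ddp i f)))
  (tstk1 := frac (act (t * s * t)%g (ddp i f)))
  (k2 := frac (ddp j (ddp i f))) (sk2 := frac (act s (ddp j (ddp i f))))
  (tsk2 := frac (act (t * s)%g (ddp j (ddp i f))))
  (k3 := frac (ddp i (ddp j (ddp i f)))) (tk3 := frac (act t (ddp i (ddp j (ddp i f)))))).
- by rewrite -fB -rj ddpE_frac.
- by rewrite -fD (act_ddpE _ srj) -actM.
- by rewrite -fD (act_ddpE _ tsrj) -actM.
- by rewrite -fB (act_ddpE _ stsrj) -actM.
- by rewrite -f2 -ri ddpE_frac.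
- by rewrite -f2 (act_ddpE _ tri) act_ddp -actM.
- by rewrite -f2 (act_ddpE _ stri) -actM (actM s t (ddp j f)) act_ddp.
- by rewrite -fB -rj ddpE_frac.
- by rewrite -fD (act_ddpE _ srj) act_ddp -actM.
- by rewrite -f2 -ri ddpE_frac.
- by rewrite -f2 -ri ddpE_frac.
- by rewrite -f2 (act_ddpE _ tri) -actM.
- by rewrite -f2 (act_ddpE _ stri) -actM.
- by rewrite -f2 (act_ddpE _ tstri) -actM /s /t -simple_refl_braid4.
- by rewrite -fB -rj ddpE_frac.
- by rewrite -fD (act_ddpE _ srj) -actM act_ddp.
- by rewrite -fD (act_ddpE _ tsrj) -actM (actM t s (ddp i f)) act_ddp.
- by rewrite -f2 -ri ddpE_frac.
- by rewrite -f2 (act_ddpE _ tri) act_ddp -actM.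
- by rewrite -fB -rj ddpE_frac.
Qed.

End Braid.

(** * Independence of the reduced word *)

Section Matsumoto.
Variables (R : idomainType) (n : nat).
Hypothesis two_neq0 : (2%:R : R) != 0.
Implicit Types (f : {mpoly R[n]}) (i j : 'I_n) (u v w : signed_perm n) (a b : seq 'I_n).

Lemma word_rcons a i : word (rcons a i) = (word a * simple_refl i)%g.
Proof. by rewrite -cats1 word_cat word1. Qed.

(** [a] is a reduced word of [w]. *)
Definition reduced w a := word a = w /\ size a = sp_length w.

Lemma reduced_rcons w a i : reduced w (rcons a i) ->
  rdesc i w /\ reduced (w * simple_refl i)%g a.
Proof.
case; rewrite word_rcons size_rcons => Ew Sw.
have Ea : word a = (w * simple_refl i)%g by rewrite -Ew -mulgA simple_reflK mulg1.
have := sp_length_min Ea; have := sp_length_mul w i.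
by case: rdesc => /= h1 h2; split=> //; try split=> //; lia.
Qed.

(** Two words [rcons p i] and [rcons q j] of the same size represent the same
    element, define the same operator, and are both final segments of reduced
    words of [w]. *)
Definition braid_move w i j :=
  exists p q : seq 'I_n, [/\ size p = size q,
    word (rcons p i) = word (rcons q j),
    forall f, foldr ddp f (rcons p i) = foldr ddp f (rcons q j) &
    sp_length w = (sp_length (w * (word (rcons p i))^-1)%g + (size p).+1)%N].

Lemma sval_s0_ne w i j : val i = 0%N -> j != i ->
  sval (w * simple_refl i)%g j = sval w j.
Proof. by move=> i0 /negPf ne; rewrite sval_s0 // ne mul1r. Qed.

Lemma sval_s0_eq w i : val i = 0%N -> sval (w * simple_refl i)%g i = - sval w i.
Proof. by move=> i0; rewrite sval_s0 // eqxx mulN1r. Qed.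

Lemma braid_move_far w i j : (i.+1 < j)%N -> rdesc i w -> rdesc j w ->
  braid_move w i j.
Proof.
move=> ij di dj; exists [:: j], [:: i]; split=> //.
- by rewrite /word !big_cons !big_nil !mulg1 (simple_refl_comm ij).
- by move=> f /=; rewrite (ddp_comm two_neq0 _ ij).
have Dj : rdesc j (w * simple_refl i)%g.
  have j0 : val j != 0%N by move=> /=; lia.
  move: dj; rewrite /rdesc (negPf j0).
  have [i0|i0] := eqVneq (val i) 0%N.
    by rewrite !sval_s0_ne // -val_eqE /=; lia.
  by rewrite !sval_si // /sw !tpermD // -val_eqE /=; lia.
rewrite /= /word !big_cons big_nil mulg1 invMg !simple_reflV mulgA.
by rewrite (sp_length_desc di) (sp_length_desc Dj) addn2.
Qed.

Lemma braid_move3 w i j : val i != 0%N -> val j = (val i).+1 ->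
  rdesc i w -> rdesc j w -> braid_move w i j.
Proof.
move=> i0 ij di dj; exists [:: i; j], [:: j; i]; split=> //.
- by rewrite /word !big_cons !big_nil !mulg1 !mulgA simple_refl_braid3.
- by move=> f /=; rewrite ddp_braid3.
have j0 : val j != 0%N by rewrite ij.
have ep := ord_prevS ij.
have nipj : ord_prev i != j by rewrite -val_eqE /=; move: ij => /=; lia.
have niip := ord_prev_neq i0.
have nij : i != j by rewrite -val_eqE /=; move: ij => /=; lia.
have Ei p : sval (w * simple_refl i)%g p = sval w (sw i p) by rewrite sval_si.
have Eij p : sval (w * simple_refl i * simple_refl j)%g p = sval w (sw i (sw j p)).
  by rewrite sval_si.
have [t1 t2 t3] : [/\ sw i (ord_prev i) = i, sw i i = ord_prev i & sw i j = j].
  by rewrite /sw tpermL tpermR tpermD.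
have [t4 t5 t6] : [/\ sw j (ord_prev i) = ord_prev i, sw j i = j & sw j j = i].
  by rewrite /sw ep tpermL tpermR tpermD // eq_sym.
move: (di) (dj); rewrite /rdesc (negPf i0) (negPf j0) ep => d1 d2.
have Dj : rdesc j (w * simple_refl i)%g.
  by rewrite /rdesc (negPf j0) ep !Ei t2 t3; lia.
have Di : rdesc i (w * simple_refl i * simple_refl j)%g.
  by rewrite /rdesc (negPf i0) !Eij t4 t5 t1 t3.
rewrite /= /word !big_cons big_nil mulg1 !invMg !simple_reflV !mulgA.
by rewrite (sp_length_desc di) (sp_length_desc Dj) (sp_length_desc Di) addn3.
Qed.

Lemma braid_move4 w i j : val i = 0%N -> val j = 1%N ->
  rdesc i w -> rdesc j w -> braid_move w i j.
Proof.
move=> i0 j1 di dj; exists [:: j; i; j], [:: i; j; i]; split=> //.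
- by rewrite /word !big_cons !big_nil !mulg1 !mulgA (simple_refl_braid4 i0 j1).
- by move=> f /=; rewrite (ddp_braid4 two_neq0 _ i0 j1).
have j0 : val j != 0%N by rewrite j1.
have ep : ord_prev j = i by apply: ord_prevS; rewrite i0.
have nji : j != i by rewrite -val_eqE i0 j1.
have [t5 t6] : sw j i = j /\ sw j j = i by rewrite /sw ep tpermL tpermR.
move: (di) (dj); rewrite /rdesc i0 eqxx (negPf j0) ep => d1 d2.
have Dj : rdesc j (w * simple_refl i)%g.
  by rewrite /rdesc (negPf j0) ep sval_s0_eq // sval_s0_ne //; lia.
have Di : rdesc i (w * simple_refl i * simple_refl j)%g.
  by rewrite /rdesc i0 eqxx sval_si // t5 sval_s0_ne //; lia.
have Dj' : rdesc j (w * simple_refl i * simple_refl j * simple_refl i)%g.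
  rewrite /rdesc (negPf j0) ep sval_s0_eq // sval_s0_ne // !(sval_si _ _ j0) t5 t6.
  by rewrite sval_s0_eq // sval_s0_ne //; lia.
rewrite /= /word !big_cons big_nil mulg1 !invMg !simple_reflV !mulgA.
rewrite (sp_length_desc di) (sp_length_desc Dj) (sp_length_desc Di).
by rewrite (sp_length_desc Dj') addn4.
Qed.

(** Two descents of [w] always come from a braid relation at the end of reduced
    words of [w]. *)
Lemma braid_moveP w i j : (i < j)%N -> rdesc i w -> rdesc j w -> braid_move w i j.
Proof.
move=> ij di dj; have [far|near] := ltnP i.+1 j; first exact: braid_move_far.
have ej : val j = (val i).+1 by move: ij near => /=; lia.
have [i0|i0] := eqVneq (val i) 0%N; last exact: braid_move3.
by apply: braid_move4 => //; rewrite ej i0.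
Qed.

(** The divided differences do not depend on the reduced word; this is the
    argument of Matsumoto. *)
Lemma ddp_reduced w a b f : reduced w a -> reduced w b ->
  foldr ddp f a = foldr ddp f b.
Proof.
move El: (size a) => l; elim: l w a b f El => [|l IH] w a b f Sa Ra Rb.
  by rewrite (size0nil Sa) (@size0nil _ b) // (proj2 Rb) -(proj2 Ra).
have Sb : size b = l.+1 by rewrite (proj2 Rb) -(proj2 Ra).
case/lastP: a => // a i in Sa Ra *; case/lastP: b => // b j in Sb Rb *.
have [di Ra'] := reduced_rcons Ra; have [dj Rb'] := reduced_rcons Rb.
move: Sa Sb; rewrite !size_rcons => -[Sa] [Sb].
have Lw : sp_length w = l.+1 by rewrite -(proj2 Ra) size_rcons Sa.
have [eij|nij] := eqVneq i j.
  rewrite eij in di Ra' Ra *; rewrite -!cats1 !foldr_cat.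
  exact: IH Ra' Rb'.
wlog ij : i j a b di dj Ra Rb Ra' Rb' Sa Sb nij / (i < j)%N.
  move=> H; case: (ltngtP i j) => ij; first exact: H.
    by apply/esym; apply: H => //; rewrite eq_sym.
  by move: nij; rewrite -val_eqE /= ij eqxx.
(* The two words of a braid relation, completed on the left by a common word,
   are compared with the given words, with which they share the last letter. *)
have [p [q [Spq Wpq Dpq Lpq]]] := braid_moveP ij di dj.
set v := (w * _)%g in Lpq.
have [c /andP[/eqP Wc /eqP Sc]] := reduced_word_ex v.
have Rp : reduced w (rcons (c ++ p) i).
  rewrite rcons_cat; split; first by rewrite word_cat Wc mulgKV.
  by rewrite size_cat size_rcons Sc Lpq.
have Rq : reduced w (rcons (c ++ q) j).
  rewrite rcons_cat; split; first by rewrite word_cat Wc -Wpq mulgKV.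
  by rewrite size_cat size_rcons Sc -Spq Lpq.
have [_ Rp'] := reduced_rcons Rp; have [_ Rq'] := reduced_rcons Rq.
transitivity (foldr ddp f (rcons (c ++ p) i)).
  by rewrite -!cats1 ![foldr _ _ (_ ++ [:: i])]foldr_cat; apply: IH Ra' Rp'.
rewrite rcons_cat foldr_cat Dpq -foldr_cat -rcons_cat.
by rewrite -!cats1 ![foldr _ _ (_ ++ [:: j])]foldr_cat; apply: (IH _ _ _ _ _ Rq' Rb');
  rewrite (proj2 Rq') -(proj2 Rb').
Qed.

Lemma dd'_spE w a f : reduced w a -> dd'_sp w f = foldr ddp f a.
Proof.
move=> Ra; have Rw : reduced w (reduced_word w).
  by have /andP[/eqP ? /eqP ?] := xchooseP (reduced_word_ex w).
by rewrite -(ddp_reduced _ Rw Ra) ddp.unlock.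
Qed.

Lemma dd'_sp1 f : dd'_sp 1%g f = f.
Proof.
by rewrite (@dd'_spE _ [::]) //; split; rewrite ?sp_length1 // /word big_nil.
Qed.

Lemma dd'_sp_mull i w f :
  sp_length (simple_refl i * w)%g = (sp_length w).+1 ->
  dd'_sp (simple_refl i * w)%g f = ddp i (dd'_sp w f).
Proof.
move=> L; have [a /andP[/eqP Wa /eqP Sa]] := reduced_word_ex w.
rewrite (@dd'_spE w a) // (@dd'_spE _ (i :: a)) //; split.
  by rewrite -cat1s word_cat word1 Wa.
by rewrite /= Sa L.
Qed.

End Matsumoto.

(** * Pfaffians *)

Section SignedDeletion.
Variables (T : Type) (R : comNzRingType).

(** The alternating sum of [f x t] over the ways to delete an entry [x] from
    [s], where [t] is what remains; the deletion of the head has sign [+]. *)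
Fixpoint sdel (f : T -> seq T -> R) (s : seq T) : R :=
  if s is x :: s' then f x s' - sdel (fun y t => f y (x :: t)) s' else 0.

Lemma eq_sdel f g s : (forall x t, (size t).+1 = size s -> f x t = g x t) ->
  sdel f s = sdel g s.
Proof.
elim: s f g => //= x s IH f g e; rewrite e //; congr (_ - _).
by apply: IH => y t st; apply: e; rewrite /= st.
Qed.

Lemma sdelB f g s : sdel (fun x t => f x t - g x t) s = sdel f s - sdel g s.
Proof. by elim: s f g => /= [|x s IH] f g; rewrite ?IH; ring. Qed.

Lemma sdelZ c f s : sdel (fun x t => c * f x t) s = c * sdel f s.
Proof. by elim: s f => /= [|x s IH] f; rewrite ?mulr0 // IH mulrBr. Qed.

(** Deleting two entries in either order gives opposite signs. *)
Lemma sdel_swap (G : T -> T -> seq T -> R) s :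
  sdel (fun x => sdel (G x)) s = - sdel (fun x => sdel (fun y => G y x)) s.
Proof.
elim: s G => [|x s IH] G /=; first by rewrite oppr0.
rewrite (sdelB (fun y t => G y x t)) (sdelB (fun y t => G x y t)).
by rewrite (IH (fun y z u => G y z (x :: u))); ring.
Qed.

(** The two orders of deletion cancel when the deleted entries play the same
    role. *)
Lemma sdel_sym (G : T -> T -> seq T -> R) s :
  (forall x y t, G x y t = G y x t) -> sdel (fun x => sdel (G x)) s = 0.
Proof.
elim: s G => //= x s IH G Gsym.
rewrite (sdelB (fun y t => G y x t)) (IH (fun y z u => G y z (x :: u))) // subr0.
by under eq_sdel => y t _ do rewrite Gsym; rewrite subrr.
Qed.

Lemma sdel_rcons f s z :
  sdel f (rcons s z) = sdel (fun x t => f x (rcons t z)) s + (-1) ^+ size s * f z s.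
Proof.
elim: s f => [|x s IH] f /=; first by rewrite expr0; ring.
by rewrite IH exprS; ring.
Qed.

Lemma sdelE x0 f s :
  sdel f s = \sum_(j < size s) (-1) ^+ j * f (nth x0 s j) (take j s ++ drop j.+1 s).
Proof.
elim: s f => [|x s IH] f; first by rewrite big_ord0.
rewrite /= big_ord_recl /= expr0 mul1r drop0 IH -sumrN; congr (_ + _).
by apply: eq_bigr => j _; rewrite /bump /= exprS mulN1r mulNr.
Qed.

Variable A : T -> T -> R.

(** The Pfaffian of the [A x y] for [x] before [y] in a sequence of even size
    [2 r], by expansion along the first row. *)
Fixpoint pfs (r : nat) (s : seq T) : R :=
  if r is r'.+1 then
    (if s is x :: s' then sdel (fun y t => A x y * pfs r' t) s' else 0)
  else 1.

(** Expansion along the last column. *)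
Lemma pfs_rcons r s z : size s = r.*2.+1 ->
  pfs r.+1 (rcons s z) = sdel (fun x t => A x z * pfs r t) s.
Proof.
elim: r s => [|r IH] [//|x s] ss.
  by case: s ss => //= _; rewrite !mulr1.
rewrite -/(pfs r.+2 (rcons (x :: s) z)).
have -> : pfs r.+2 (rcons (x :: s) z) = sdel (fun y t => A x y * pfs r.+1 t) (rcons s z) by [].
rewrite sdel_rcons; case: ss => ss; rewrite ss -signr_odd odd_double expr0 mul1r addrC.
have -> : sdel (fun x1 t => A x x1 * pfs r.+1 (rcons t z)) s =
   - sdel (fun y t => A y z * pfs r.+1 (x :: t)) s; last by [].
under eq_sdel => y t st.
  rewrite IH; last by move: st; rewrite ss doubleS => -[].
  rewrite -sdelZ; over.
rewrite (sdel_swap (fun y w t => A x y * (A w z * pfs r t))); congr (- _).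
apply: eq_sdel => y t st /=; rewrite -sdelZ; apply: eq_sdel => w u _.
by rewrite mulrCA.
Qed.

(** If the first row is [c] times the last column, then only the corner entry
    [A x z = c] contributes to the expansion along the first row: expanding the
    other terms along the last column gives a sum over ordered pairs of entries
    in which opposite orders cancel. *)
Lemma pfs_cons_rcons r x z c s : size s = r.*2 ->
  (forall y, A x y = c * A y z) -> A z z = 1 ->
  pfs r.+1 (x :: rcons s z) = c * pfs r s.
Proof.
move=> ss Ax Az.
have -> : pfs r.+1 (x :: rcons s z) = sdel (fun y t => A x y * pfs r t) (rcons s z) by [].
rewrite sdel_rcons ss -signr_odd odd_double expr0 mul1r Ax Az mulr1.
suff -> : sdel (fun y t => A x y * pfs r (rcons t z)) s = 0 by rewrite add0r.
case: r ss => [|r] ss; first by rewrite (size0nil ss).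
under eq_sdel => y t st.
  rewrite pfs_rcons; last by move: st; rewrite ss doubleS => -[].
  rewrite Ax -sdelZ; over.
apply: (sdel_sym (G := fun y w t => c * A y z * (A w z * pfs r t))) => y w t.
by ring.
Qed.

End SignedDeletion.

Section PfaffianExpansion.

(** A permutation is determined by one of its values and the induced
    permutation of the other positions and values. *)
Lemma lift_perm_ex n (s : 'S_n.+1) i : exists t, s = lift_perm i (s i) t.
Proof.
pose g k := odflt k (unlift (s i) (s (lift i k))).
have gK k : lift (s i) (g k) = s (lift i k).
  have : s i != s (lift i k) by rewrite (inj_eq perm_inj) neq_lift.
  by rewrite /g => /unlift_some[k' -> ->].
have g_inj : injective g.
  by move=> k l e; apply/(@lift_inj _ i)/(@perm_inj _ s); rewrite -!gK e.
exists (perm g_inj); apply/permP => k.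
case: (unliftP i k) => [k'|] ->; last by rewrite lift_perm_id.
by rewrite lift_perm_lift permE gK.
Qed.

Lemma lift_perm_inj n (i j : 'I_n.+1) : injective (lift_perm i j).
Proof.
move=> s t /permP e; apply/permP => k; apply/(@lift_inj _ j).
by have := e (lift i k); rewrite !lift_perm_lift.
Qed.

Lemma sum_lift_perm (V : nmodType) n (i j : 'I_n.+1) (P : pred 'S_n.+1) (F : 'S_n.+1 -> V) :
  \sum_(s | P s && (s i == j)) F s =
  \sum_(t | P (lift_perm i j t)) F (lift_perm i j t).
Proof.
have [g gK] : exists g : 'S_n.+1 -> 'S_n, cancel (lift_perm i j) g.
  exists (fun s => odflt 1%g [pick t | lift_perm i j t == s]) => t.
  by case: pickP => [u /eqP /lift_perm_inj -> //|/(_ t)]; rewrite eqxx.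
rewrite (reindex_onto (lift_perm i j) g) /=.
  by apply: eq_bigl => t; rewrite lift_perm_id eqxx gK eqxx !andbT.
move=> s /andP[_ /eqP si]; have [t] := lift_perm_ex s i.
by rewrite si => ->; rewrite gK.
Qed.

Variables (R : comNzRingType) (r : nat).

(** The smallest index comes first in the permutation encoding a matching. *)
Lemma is_matching0 (s : {perm 'I_(r.+1).*2}) : is_matching s ->
  s (ord0 : 'I_(r.*2).+2) = ord0 :> 'I_(r.*2).+2.
Proof.
case/andP=> /forallP m1 /forallP m2; apply/val_inj => /=.
have [x ex] : exists x, s x = (ord0 : 'I_(r.*2).+2).
  by exists (s^-1%g (ord0 : 'I_(r.*2).+2)); rewrite permKV.
have h := odd_double_half x.
have lt : (x./2 < r.+1)%N by have := ltn_ord x; move: h; case: odd; lia.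
have := m1 (Ordinal lt); have := m2 (ord0 : 'I_r.+1) => /forallP/(_ (Ordinal lt))/implyP /=.
case: (boolP (odd x)) h => ox h.
  have -> : pf_odd (Ordinal lt) = x by apply: val_inj => /=; lia.
  by rewrite ex.
have -> : pf_even (Ordinal lt) = x by apply: val_inj => /=; lia.
rewrite ex /=; case: posnP => [x0 _ _|_ /(_ isT) //].
suff -> : (ord0 : 'I_(r.*2).+2) = x by rewrite ex.
by apply: val_inj; rewrite /= -h x0.
Qed.

(** The increasing injection of the [2 r] indices into the [2 r + 2] indices that
    avoids [0] and [j + 1]. *)
Definition pf_skip (j : 'I_(r.*2).+1) (p : 'I_r.*2) : 'I_(r.+1).*2 :=
  lift (ord0 : 'I_(r.*2).+2) (lift j p).

(** The matching [s] extended by the pair of [0] and [j + 1]. *)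
Definition pf_extend (j : 'I_(r.*2).+1) (s : {perm 'I_r.*2}) : {perm 'I_(r.+1).*2} :=
  lift_perm (ord0 : 'I_(r.*2).+2) ord0 (lift_perm ord0 j s).

Lemma pf_extend0 j s : pf_extend j s (pf_even (ord0 : 'I_r.+1)) = (ord0 : 'I_(r.*2).+2).
Proof.
have -> : pf_even (ord0 : 'I_r.+1) = (ord0 : 'I_(r.*2).+2) by apply: val_inj.
exact: lift_perm_id.
Qed.

Lemma pf_extend1 j s :
  pf_extend j s (pf_odd (ord0 : 'I_r.+1)) = lift (ord0 : 'I_(r.*2).+2) j.
Proof.
have -> : pf_odd (ord0 : 'I_r.+1) = lift (ord0 : 'I_(r.*2).+2) ord0 by apply: val_inj.
by rewrite /pf_extend lift_perm_lift lift_perm_id.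
Qed.

Lemma pf_extendS j s (x : 'I_r.*2) :
  pf_extend j s (pf_skip ord0 x) = pf_skip j (s x).
Proof. by rewrite /pf_extend /pf_skip !lift_perm_lift. Qed.

Lemma pf_even_lift (p : 'I_r) : pf_even (lift ord0 p) = pf_skip ord0 (pf_even p).
Proof. by apply: val_inj. Qed.

Lemma pf_odd_lift (p : 'I_r) : pf_odd (lift ord0 p) = pf_skip ord0 (pf_odd p).
Proof. by apply: val_inj. Qed.

Lemma pf_skip_lt j x y : (pf_skip j x < pf_skip j y)%N = (x < y)%N.
Proof. by rewrite /= /bump; case: (leqP j x); case: (leqP j y) => /=; lia. Qed.

Lemma is_matching_extend j s : is_matching (pf_extend j s) = is_matching s.
Proof.
apply/idP/idP => /andP[/forallP m1 /forallP m2]; apply/andP; split; apply/forallP => p.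
- by have := m1 (lift ord0 p); rewrite pf_even_lift pf_odd_lift !pf_extendS pf_skip_lt.
- apply/forallP => q; apply/implyP => pq.
  have /forallP/(_ (lift ord0 q))/implyP := m2 (lift ord0 p).
  by rewrite !pf_even_lift !pf_extendS pf_skip_lt; apply.
- case: (unliftP ord0 p) => [p'|] ->; last by rewrite pf_extend0 pf_extend1.
  by rewrite pf_even_lift pf_odd_lift !pf_extendS pf_skip_lt.
- apply/forallP => q; apply/implyP.
  case: (unliftP ord0 q) => [q'|] -> //.
  case: (unliftP ord0 p) => [p'|] -> pq; last by rewrite pf_extend0 pf_even_lift pf_extendS.
  rewrite !pf_even_lift !pf_extendS pf_skip_lt.
  by have /forallP/(_ q')/implyP := m2 p'; apply.
Qed.

Lemma odd_pf_extend j s : odd_perm (pf_extend j s) = odd j (+) odd_perm s.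
Proof. by rewrite /pf_extend !odd_lift_perm /=. Qed.

(** Expansion along the first row: the matchings are sorted by the partner
    [j + 1] of [0]. *)
Lemma pfaffian_expand (a : 'I_(r.+1).*2 -> 'I_(r.+1).*2 -> R) :
  pfaffian a = \sum_(j < r.*2.+1) (-1) ^+ j *
    (a (ord0 : 'I_(r.*2).+2) (lift (ord0 : 'I_(r.*2).+2) j) *
     pfaffian (fun p q => a (pf_skip j p) (pf_skip j q))).
Proof.
rewrite /pfaffian.
pose F (s : 'S_(r.*2).+2) := (-1) ^+ s *
  \prod_(p < r.+1) a (s (pf_even p)) (s (pf_odd p)) : R.
transitivity (\sum_(s : 'S_(r.*2).+2 | @is_matching r.+1 s && (s ord0 == ord0)) F s).
  apply: eq_bigl => s; case: (boolP (@is_matching r.+1 s)) => //= ms.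
  by rewrite (is_matching0 ms) eqxx.
rewrite sum_lift_perm (partition_big (fun t : 'S_(r.*2).+1 => t ord0) predT) //=.
apply: eq_bigr => j _; rewrite sum_lift_perm !big_distrr /=.
apply: eq_big => s; first exact: is_matching_extend.
move=> _; rewrite -/(pf_extend j s) /F odd_pf_extend signr_addb signr_odd.
rewrite big_ord_recl pf_extend0 pf_extend1 -!mulrA; congr (_ * _).
rewrite mulrCA; congr (_ * (_ * _)); apply: eq_bigr => p _.
by rewrite pf_even_lift pf_odd_lift !pf_extendS.
Qed.

End PfaffianExpansion.

Lemma nth_delete (T : Type) (x0 : T) (s : seq T) (j p : nat) : (j < size s)%N ->
  nth x0 (take j s ++ drop j.+1 s) p = nth x0 s (bump j p).
Proof.
move=> js; rewrite nth_cat size_takel; last exact: ltnW.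
rewrite /bump; case: (leqP j p) => pj; last by rewrite nth_take.
by rewrite nth_drop; congr nth; rewrite /=; lia.
Qed.

Lemma eq_pfaffian (R : comNzRingType) r (a b : 'I_r.*2 -> 'I_r.*2 -> R) :
  (forall i j, a i j = b i j) -> pfaffian a = pfaffian b.
Proof.
by move=> e; apply: eq_bigr => s _; congr (_ * _); apply: eq_bigr => p _; rewrite e.
Qed.

(** The Pfaffian defined by matchings agrees with the recursive one. *)
Lemma pfaffian_pfs (T : Type) (x0 : T) (R : comNzRingType) (A : T -> T -> R) r s :
  size s = r.*2 ->
  @pfaffian R r (fun i j => A (nth x0 s i) (nth x0 s j)) = pfs A r s.
Proof.
elim: r s => [|r IH] s ss.
  rewrite /pfaffian (bigD1 1%g) /=; last first.
    by apply/andP; split; apply/forallP => -[].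
  rewrite odd_perm1 expr0 mul1r big_ord0 big1 ?addr0 // => t /andP[_ /eqP[]].
  by apply/permP => -[].
case: s ss => // x s [] ss; rewrite pfaffian_expand /= (sdelE x0) ss.
apply: eq_bigr => j _; congr (_ * (_ * _)).
rewrite -IH; last first.
  by rewrite size_cat size_takel ?size_drop ss ?(ltnW (ltn_ord j)) //; have := ltn_ord j; lia.
by apply: eq_pfaffian => p q /=; rewrite !nth_delete ?ss.
Qed.

(** * The polynomials [Qt] *)

Section QTildeFactor.
Variables (R : comNzRingType) (n : nat).

Lemma Qt2_top j : Qt2 R n n j = Qt1 R n n * Qt1 R n j.
Proof.
rewrite /Qt2 big_nat big1 ?mulr0 ?addr0 // => p /andP[p0 _].
by rewrite {1}/Qt1 mesym_geqnE ?mulr0 ?mul0r //; lia.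
Qed.

Lemma Qt2_0 j : Qt2 R n j 0 = Qt1 R n j.
Proof. by rewrite /Qt2 big_geq // mulr0 addr0 {2}/Qt1 mesym0E mulr1. Qed.

Lemma Qt_pfs la : Qt R n la =
  pfs (Qt2 R n) (uphalf (size la)) (if odd (size la) then rcons la 0%N else la).
Proof.
rewrite -(@pfaffian_pfs _ 0%N); last first.
  have := odd_double_half (size la); rewrite uphalf_half.
  by case: odd; rewrite ?size_rcons; lia.
apply: eq_pfaffian => i j; case: odd => //; rewrite !nth_rcons.
by congr Qt2; case: ltngtP => // h; rewrite nth_default //; lia.
Qed.

(** The factorization [Q_(n, la) = e_n Q_la]. The entries [Q_(n, j) = e_n e_j] and
    [Q_(i, 0) = e_i] make the row of [n] proportional to the column of a part 0.
    If [la] has an odd number of parts, this column is the one that completes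
    [la] to an even number of parts; otherwise it completes [n :: la]. *)
Lemma Qt_cons_top la : Qt R n (n :: la) = mesym n R n * Qt R n la.
Proof.
rewrite !Qt_pfs /=; have := odd_double_half (size la).
case: (boolP (odd (size la))) => ola /= h.
  rewrite uphalf_half ola; have sla : size la = (size la)./2.*2.+1 by lia.
  rewrite add1n (pfs_rcons (Qt2 R n) _ sla) /= -sdelZ; apply: eq_sdel => y t _.
  by rewrite Qt2_top Qt2_0 mulrA.
rewrite uphalf_half (negPf ola) add0n.
apply: pfs_cons_rcons; first by lia.
- by move=> y; rewrite Qt2_top Qt2_0.
- by rewrite Qt2_0 /Qt1 mesym0E.
Qed.

End QTildeFactor.

Section QTildeMorphism.
Variables (R S : comNzRingType) (n m : nat).

(** A morphism mapping elementary symmetric polynomials to elementary symmetric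
    polynomials does the same for the polynomials [Q_la]. *)
Lemma Qt_morph (T : {rmorphism {mpoly R[n]} -> {mpoly S[m]}}) la :
  (forall k, T (mesym n R k) = mesym m S k) -> T (Qt R n la) = Qt S m la.
Proof.
move=> Te; rewrite /Qt /pfaffian rmorph_sum; apply: eq_bigr => s _.
rewrite rmorphM rmorph_sign rmorph_prod; congr (_ * _); apply: eq_bigr => p _.
rewrite /Qt2 rmorphD !rmorphM rmorph_nat /Qt1 !Te; congr (_ + _ * _).
by rewrite rmorph_sum; apply: eq_bigr => q _; rewrite !rmorphM rmorph_sign !Te.
Qed.

End QTildeMorphism.

Section Symmetric.
Variables (R : comNzRingType) (n : nat).

Lemma act_mesym i k : val i != 0%N -> act (simple_refl i) (mesym n R k) = mesym n R k.
Proof.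
move=> i0; rewrite -[in RHS](issymP _ (mesym_sym n R k) (sw i)).
pose h : {rmorphism _ -> _} := (msym (sw i) : {mpoly R[n]} -> {mpoly R[n]}).
rewrite -[RHS]/(h _); apply: mpoly_morph_eq => [c|j] /=.
  by rewrite actC -[c%:MP]mulr1 mul_mpolyC msymZ rmorph1.
rewrite act_si // msymX; congr mpolyX; apply/mnmP => l; rewrite !mnmE.
by rewrite (can2_eq (permK _) (permKV _)) /sw tpermV.
Qed.

Lemma act_Qt i la : val i != 0%N -> act (simple_refl i) (Qt R n la) = Qt R n la.
Proof. by move=> i0; apply: Qt_morph => k; apply: act_mesym. Qed.

End Symmetric.

Lemma act_Qt_double n (i : 'I_n) : val i != 0%N ->
  act (simple_refl i) (Qt_double n) = Qt_double n.
Proof.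
move=> i0; rewrite /Qt_double rmorph_sum; apply: eq_bigr => A _.
by rewrite rmorphM; congr (_ * _); [exact: act_Qt | exact: actC].
Qed.

Lemma int_mpoly2_neq0 n : (2%:R : {mpoly int[n]}) != 0.
Proof. by rewrite -mpolyC_nat mpolyC_eq0. Qed.

(** * Double Schubert polynomials along descents *)

Section SchubertRecursion.
Variable n : nat.
Implicit Types (i : 'I_n) (w : signed_perm n) (f g : dpoly n).

Lemma ddp_sign i k f : ddp i ((-1) ^+ k * f) = (-1) ^+ k * ddp i f.
Proof.
by rewrite mulrC (ddpM_inv (int_mpoly2_neq0 n)) ?rmorph_sign // mulrC.
Qed.

Lemma sval_w0 p : sval (w0 n) p = - p.+1%:Z.
Proof. by rewrite /sval ffunE perm1 mulN1r. Qed.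

Lemma sval_w0M w p : sval (w0 n * w)%g p = - sval w p.
Proof. by rewrite svalM sval_w0 mulrN. Qed.

Lemma w0K : (w0 n * w0 n = 1)%g.
Proof.
by apply: sval_inj => p; rewrite sval_w0M sval_w0 opprK /sval sp_sgn1 sp_abs1 mul1r.
Qed.

(** Descending in the weak order is applying a divided difference. *)
Lemma schubertC_desc i w : rdesc i w ->
  schubertC (w * simple_refl i)%g = ddp i (schubertC w).
Proof.
move=> d; rewrite /schubertC ddp_sign invMg simple_reflV -mulgA.
rewrite (dd'_sp_mull (int_mpoly2_neq0 n)) //.
rewrite -sp_lengthV -[in RHS]sp_lengthV !invMg invgK simple_reflV.
have -> : ((w0 n)^-1 = w0 n)%g by apply/eqP; rewrite eq_invg_mul w0K.
have := sp_length_mul (w0 n * w)%g i.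
suff -> : rdesc i (w0 n * w)%g = false by rewrite /= addn0 addn1.
apply/negbTE; move: d; rewrite /rdesc !sval_w0M; case: (val i == 0%N); lia.
Qed.

Lemma schubertC_w0 :
  schubertC (w0 n) = (-1) ^+ (n * (n - 1))./2 * (Delta n * Qt_double n).
Proof. by rewrite /schubertC mulVg (dd'_sp1 (int_mpoly2_neq0 n)). Qed.

(** The product over all positions [p] of the [x_p - y_j], where [y_j] runs
    through the first [e p] variables. *)
Definition stair (e : 'I_n -> nat) : dpoly n :=
  \prod_(p < n) \prod_(j < n | (j < e p)%N) ('X_p - ('X_j)%:MP).

Lemma act_stair i e : val i != 0%N -> e (ord_prev i) = e i ->
  act (simple_refl i) (stair e) = stair e.
Proof.
move=> i0 ei; rewrite [in RHS]/stair (reindex_inj (@perm_inj _ (sw i))) /=.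
rewrite /stair rmorph_prod; apply: eq_bigr => p _; rewrite rmorph_prod.
have -> : e (sw i p) = e p by rewrite /sw; case: tpermP => [->|->|_ _].
by apply: eq_bigr => j _; rewrite rmorphB /= actC act_si.
Qed.

(** If the exponents in two adjacent positions differ by [1], then the product is
    the product of a linear factor and of a polynomial which is symmetric in the
    two variables. *)
Lemma ddp_stair i e e' f : val i != 0%N -> act (simple_refl i) f = f ->
  (e i < n)%N -> e (ord_prev i) = (e i).+1 -> e' (ord_prev i) = e i ->
  (forall p, p != ord_prev i -> e' p = e p) ->
  ddp i (stair e * f) = - (stair e' * f).
Proof.
move=> i0 sf lt_ei ep e'p e'e; have nip := ord_prev_neq i0.
have E : stair e = ('X_(ord_prev i) - ('X_(Ordinal lt_ei))%:MP) * stair e'.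
  rewrite /stair (bigD1 (ord_prev i)) //= [in RHS](bigD1 (ord_prev i)) //= mulrA.
  congr (_ * _); last first.
    by apply: eq_bigr => p np; rewrite e'e.
  rewrite (bigD1 (Ordinal lt_ei)) /=; last by rewrite ep.
  congr (_ * _); apply: eq_bigl => j; rewrite ep e'p -val_eqE /=.
  by case: (ltngtP j (e i)) => h; lia.
have sG : act (simple_refl i) (stair e') = stair e'.
  by apply: act_stair => //; rewrite e'p e'e // eq_sym.
apply: (ddp_unique (int_mpoly2_neq0 n)); rewrite E srootS // !rmorphM rmorphB /=.
by rewrite sf sG actC act_si // /sw tpermL; ring.
Qed.

End SchubertRecursion.

(** * The polynomial of [w_rho n] *)

Section ChainToRho.
Variable n : nat.

Lemma sval_w_rho (p : 'I_n) : sval (w_rho n) p = - (n - p)%N%:Z.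
Proof. by rewrite /sval ffunE permE /= mulN1r subnSK. Qed.

(** The permutations and the exponents of the chain from [w0] to [w_rho]. During
    the pass number [n - c], the smallest of the first [c + 1] letters, all barred
    and in increasing order of the absolute values, moves right to position [c],
    counting from 0; it has reached position [k]. *)
Definition chain_val (c k p : nat) : int :=
  if (p < k)%N then - (n - c + p + 1)%N%:Z
  else if p == k then - (n - c)%N%:Z
  else if (p <= c)%N then - (n - c + p)%N%:Z
  else - (n - p)%N%:Z.

Definition chain_exp (c k p : nat) : nat :=
  if (p < k)%N then (c - p.+1)%N else (c - p)%N.

(** The parity of [c (c + 1) / 2 - k], the number of remaining linear factors. *)
Definition chain_odd (c k : nat) : bool := odd (c * c.+1)./2 (+) odd k.

Definition chain_at (c k : nat) : Prop :=
  exists w : signed_perm n, (forall p : 'I_n, sval w p = chain_val c k p) /\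
    schubertC w = (-1) ^+ chain_odd c k *
      (stair (fun p : 'I_n => chain_exp c k p) * Qt_double n).

Lemma chain_step c k : (c < n)%N -> (k < c)%N -> chain_at c k -> chain_at c k.+1.
Proof.
move=> cn kc [w [wE Cw]].
have lt : (k.+1 < n)%N by lia.
pose i := Ordinal lt.
have i0 : val i != 0%N by [].
have di : rdesc i w.
  by rewrite /rdesc /= !wE /chain_val /= eqxx ltnn; do ?case: ifP; lia.
exists (w * simple_refl i)%g; split=> [p|].
  rewrite sval_si // wE /sw /chain_val.
  case: tpermP => [->|->|/eqP + /eqP] /=; rewrite -?val_eqE /=;
    case: (ltngtP p k) => ?; do ?case: ifP; try lia.
rewrite (schubertC_desc di) Cw ddp_sign /chain_odd /= addbN.
set b := (_ (+) _).
have -> : (-1) ^+ (~~ b) = - (-1) ^+ b :> dpoly n by case: b; rewrite ?opprK.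
rewrite mulNr -mulrN; congr (_ * _).
apply: ddp_stair => //; rewrite ?act_Qt_double //= /chain_exp ?ltnSn ?ltnn.
- by case: ifP; lia.
- by case: ifP; lia.
- by case: ifP; lia.
- by move=> p; rewrite -val_eqE /= => np; do ?case: ifP; lia.
Qed.

Lemma chain_oddS c : chain_odd c.+1 c.+1 = chain_odd c 0.
Proof.
rewrite /chain_odd (_ : c.+1 * c.+2 = c * c.+1 + c.+1.*2)%N; last by lia.
by rewrite halfD odd_double andbF add0n doubleK oddD addbK addbF.
Qed.

Lemma chain_pass c : (c.+1 < n)%N -> chain_at c.+1 0 -> chain_at c 0.
Proof.
move=> cn H; have [w [wE Cw]] : chain_at c.+1 c.+1.
  have : (c.+1 <= c.+1)%N by [].
  by elim: {1 4}c.+1 => [//|k IH] kc; apply: chain_step; [lia | lia | apply: IH; lia].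
exists w; split=> [p|]; first by rewrite wE /chain_val; do ?case: ifP; lia.
rewrite Cw chain_oddS; congr (_ * (_ * _)).
apply: eq_bigr => p _; apply: eq_bigl => j; congr (_ < _)%N.
by rewrite /chain_exp /=; case: ifP; lia.
Qed.

Lemma chain_start : (0 < n)%N -> chain_at n.-1 0.
Proof.
move=> n0; exists (w0 n); split=> [p|].
  by rewrite sval_w0 /chain_val; have := ltn_ord p; do ?case: ifP; lia.
have -> : chain_odd n.-1 0 = odd (n * (n - 1))./2.
  by rewrite /chain_odd prednK // addbF mulnC subn1.
rewrite schubertC_w0 signr_odd; congr (_ * (_ * _)); apply: eq_bigr => p _; apply: eq_bigl => j.
by rewrite /chain_exp /=; have := ltn_ord p; lia.
Qed.

(** The divided difference for the longest permutation maps [Delta] to [1] up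
    to sign, and [Qt_double] is symmetric in the [x_i]. *)
Lemma schubertC_rho : schubertC (w_rho n) = Qt_double n.
Proof.
have [n0|n0] := posnP n.
  have -> : w_rho n = w0 n by apply: sval_inj => p; have := ltn_ord p; lia.
  have e0 : (n * (n - 1))./2 = 0%N by rewrite n0.
  rewrite schubertC_w0 e0 expr0 mul1r /Delta big1 ?mul1r // => p _.
  by have := ltn_ord p; lia.
have [w [wE Cw]] : chain_at 0 0.
  have : (n.-1 <= n.-1)%N by [].
  elim: {1 2}n.-1 (chain_start n0) => [//|c IH] H lc.
  by apply: IH; [apply: chain_pass H; lia | lia].
have -> : w_rho n = w.
  apply: sval_inj => p; rewrite wE sval_w_rho /chain_val.
  by do ?case: ifP; lia.
rewrite Cw /chain_odd expr0 mul1r /stair big1 ?mul1r // => p _.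
by rewrite big1 // => j; rewrite /chain_exp /=; lia.
Qed.

End ChainToRho.

(** * Truncation of the variables *)

(** The value of the variable of index [i < n] under the truncation to [m]
    variables. *)
Definition zvar (m n : nat) (R : comNzRingType) (i : 'I_n) : {mpoly R[m]} :=
  if insub (val i) is Some j then 'X_j else 0.

(** Sealed copies of the truncation and of its action on the coefficients. *)
HB.lock Definition zcoef (m n : nat) (c : {mpoly int[n]}) : {mpoly int[m]} :=
  c \mPo [tuple zvar m int i | i < n].

HB.lock Definition trunc (m n : nat) (f : dpoly n) : dpoly m := trunc_vars m f.

Section Truncation.
Variables (m n : nat).

Fact zcoef_additive : {morph @zcoef m n : f g / f - g}.
Proof. by move=> f g; rewrite zcoef.unlock rmorphB. Qed.
Fact zcoef_multiplicative : monoid_morphism (@zcoef m n).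
Proof. by rewrite zcoef.unlock; split=> [|f g]; rewrite (rmorph1, rmorphM). Qed.

HB.instance Definition _ := GRing.isAdditive.Build _ _ (@zcoef m n) zcoef_additive.
HB.instance Definition _ :=
  GRing.isMonoidMorphism.Build _ _ (@zcoef m n) zcoef_multiplicative.

Let zcoefC : {rmorphism {mpoly int[n]} -> dpoly m} :=
  @mpolyC m {mpoly int[m]} \o @zcoef m n.

Lemma trunc_mmap : @trunc m n = mmap zcoefC (@zvar m n {mpoly int[m]}).
Proof. by rewrite trunc.unlock /zcoefC /= zcoef.unlock. Qed.

Fact trunc_additive : {morph @trunc m n : f g / f - g}.
Proof. by move=> f g; rewrite trunc_mmap rmorphB. Qed.
Fact trunc_multiplicative : monoid_morphism (@trunc m n).
Proof. by rewrite trunc_mmap; split=> [|f g]; rewrite (rmorph1, rmorphM). Qed.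

HB.instance Definition _ := GRing.isAdditive.Build _ _ (@trunc m n) trunc_additive.
HB.instance Definition _ :=
  GRing.isMonoidMorphism.Build _ _ (@trunc m n) trunc_multiplicative.

Lemma zcoefX i : zcoef m ('X_i : {mpoly int[n]}) = zvar m int i.
Proof. by rewrite zcoef.unlock comp_mpolyXU -tnth_nth tnth_mktuple. Qed.

Lemma zcoef_int c : zcoef m (c%:MP : {mpoly int[n]}) = c%:MP.
Proof. by rewrite zcoef.unlock comp_mpolyC. Qed.

Lemma trunc_var i : trunc m ('X_i : dpoly n) = zvar m {mpoly int[m]} i.
Proof. by rewrite trunc_mmap mmapX mmap1U. Qed.

Lemma trunc_const c : trunc m (c%:MP : dpoly n) = (zcoef m c)%:MP.
Proof. by rewrite trunc_mmap mmapC. Qed.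

Lemma zvar_lt R (i : 'I_n) (lt : (i < m)%N) : zvar m R i = 'X_(Ordinal lt).
Proof. by rewrite /zvar insubT. Qed.

Lemma zvar_ge R (i : 'I_n) : (m <= i)%N -> zvar m R i = 0.
Proof. by move=> ge; rewrite /zvar insubF // ltnNge ge. Qed.

End Truncation.

Section TruncationComposition.
Variables (m k n : nat).
Hypothesis mk : (m <= k)%N.

Lemma zcoef_comp (c : {mpoly int[n]}) : zcoef m (zcoef k c) = zcoef m c.
Proof.
pose h : {rmorphism {mpoly int[n]} -> {mpoly int[m]}} := @zcoef m k \o @zcoef k n.
rewrite -[LHS]/(h c); apply: mpoly_morph_eq => [a|i] /=; first by rewrite !zcoef_int.
rewrite !zcoefX; case: (ltnP i k) => ik; last by rewrite !zvar_ge ?rmorph0 // (leq_trans mk).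
rewrite zvar_lt zcoefX; case: (ltnP i m) => im; last by rewrite !zvar_ge.
by rewrite !zvar_lt; congr 'X_(_); apply: val_inj.
Qed.

Lemma trunc_comp (f : dpoly n) : trunc m (trunc k f) = trunc m f.
Proof.
pose h : {rmorphism dpoly n -> dpoly m} := @trunc m k \o @trunc k n.
rewrite -[LHS]/(h f); apply: mpoly_morph_eq => [a|i] /=.
  by rewrite !trunc_const zcoef_comp.
rewrite !trunc_var; case: (ltnP i k) => ik; last by rewrite !zvar_ge ?rmorph0 // (leq_trans mk).
rewrite zvar_lt trunc_var; case: (ltnP i m) => im; last by rewrite !zvar_ge.
by rewrite !zvar_lt; congr 'X_(_); apply: val_inj.
Qed.

End TruncationComposition.

Section TruncationSymmetric.
Variable m : nat.

Lemma morph_mesym (R S : comNzRingType) (T : {rmorphism {mpoly R[m.+1]} -> {mpoly S[m]}}) k :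
  (forall i, T 'X_(widen_ord (leqnSn m) i) = 'X_i) -> T 'X_ord_max = 0 ->
  T (mesym m.+1 R k) = mesym m S k.
Proof.
move=> TX T0; case: k => [|k]; first by rewrite !mesym0E rmorph1.
rewrite mesymSS rmorphD rmorphM /= T0 mulr0 addr0 /mesym.
rewrite [mwiden _]rmorph_sum rmorph_sum; apply: eq_bigr => h _.
rewrite /= [mwiden _]rmorph_prod rmorph_prod; apply: eq_bigr => i _.
by rewrite /= mwidenX mnmwiden1 TX.
Qed.

Lemma zvar_widen R i : zvar m R (widen_ord (leqnSn m) i) = 'X_i.
Proof.
have lt : (widen_ord (leqnSn m) i < m)%N by rewrite /=.
by rewrite zvar_lt; congr 'X_(_); apply: val_inj.
Qed.

Lemma zvar_max R : zvar m R (@ord_max m) = 0.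
Proof. by rewrite zvar_ge. Qed.

Lemma zcoef_mesym k : zcoef m (mesym m.+1 int k) = mesym m int k.
Proof.
by apply: morph_mesym => [i|] /=; rewrite zcoefX ?zvar_widen ?zvar_max.
Qed.

Lemma trunc_mesym k : trunc m (mesym m.+1 {mpoly int[m.+1]} k) = mesym m {mpoly int[m]} k.
Proof.
by apply: morph_mesym => [i|] /=; rewrite trunc_var ?zvar_widen ?zvar_max.
Qed.

Lemma zcoef_Qt la : zcoef m (Qt int m.+1 la) = Qt int m la.
Proof. by apply: Qt_morph => k; apply: zcoef_mesym. Qed.

Lemma trunc_Qt la : trunc m (Qt {mpoly int[m.+1]} m.+1 la) = Qt {mpoly int[m]} m la.
Proof. by apply: Qt_morph => k; apply: trunc_mesym. Qed.

End TruncationSymmetric.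

Lemma widen_ord_injective m n (mn : (m <= n)%N) : injective (widen_ord mn).
Proof. by move=> i j /(congr1 val) /= e; apply: val_inj. Qed.

Section StrictPartitions.
Variable m : nat.
Local Notation wid := (widen_ord (leqnSn m)).
Implicit Types (A : {set 'I_m}).

(** [A] as a set of parts at most [m + 1]. *)
Definition lift_set A : {set 'I_m.+1} := wid @: A.

Lemma mem_lift_set A i : (wid i \in lift_set A) = (i \in A).
Proof. exact/mem_imset/widen_ord_injective. Qed.

Lemma max_lift_set A : (ord_max \in lift_set A) = false.
Proof.
apply/negP => /imsetP[i _ /(congr1 val) /= e].
by have := ltn_ord i; rewrite -e ltnn.
Qed.

Lemma ord_maxP (P : 'I_m.+1 -> Prop) : P ord_max -> (forall i, P (wid i)) -> forall i, P i.
Proof.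
move=> Pm Pw i; have [lt|ge] := ltnP i m.
  by have -> : i = wid (Ordinal lt) by apply: val_inj.
by have -> : i = ord_max by apply: val_inj => /=; have := ltn_ord i; lia.
Qed.

Lemma wid_neq_max i : (wid i == ord_max) = false.
Proof. by rewrite -val_eqE /= ltn_eqF. Qed.

Lemma lift_setC A : ~: lift_set A = ord_max |: lift_set (~: A).
Proof.
apply/setP; apply: ord_maxP => [|i].
  by rewrite !inE eqxx max_lift_set.
by rewrite !inE wid_neq_max !mem_lift_set inE.
Qed.

Lemma lift_setUC A : ~: (ord_max |: lift_set A) = lift_set (~: A).
Proof. by apply: setC_inj; rewrite setCK lift_setC setCK. Qed.

Lemma sum_set_ordS (V : nmodType) (F : {set 'I_m.+1} -> V) :
  \sum_A F A = \sum_A F (ord_max |: lift_set A) + \sum_A F (lift_set A).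
Proof.
pose g (B : {set 'I_m.+1}) := [set i | wid i \in B].
rewrite (bigID (fun B : {set 'I_m.+1} => ord_max \in B)) /=; congr (_ + _).
  rewrite (reindex_onto (fun A => ord_max |: lift_set A) g) /=.
    apply: eq_bigl => A; rewrite setU11 /=; apply/eqP/setP => i.
    by rewrite !inE wid_neq_max mem_lift_set.
  move=> B Bm; apply/setP; apply: ord_maxP => [|i]; first by rewrite setU11.
  by rewrite !inE wid_neq_max mem_lift_set inE.
rewrite (reindex_onto lift_set g) /=.
  apply: eq_bigl => A; rewrite max_lift_set /=; apply/eqP/setP => i.
  by rewrite inE mem_lift_set.
move=> B /negbTE Bm; apply/setP; apply: ord_maxP => [|i]; first by rewrite max_lift_set Bm.
by rewrite mem_lift_set inE.
Qed.

Lemma enum_set n (B : {set 'I_n}) : enum B = [seq i <- enum 'I_n | i \in B].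
Proof. by rewrite enumT. Qed.

Lemma strict_part_lift A : strict_part (lift_set A) = strict_part A.
Proof.
rewrite /strict_part !enum_set enum_ordSr filter_rcons max_lift_set filter_map -map_comp.
by congr rev; congr map; apply: eq_filter => i; rewrite /= mem_lift_set.
Qed.

Lemma strict_part_max A : strict_part (ord_max |: lift_set A) = m.+1 :: strict_part A.
Proof.
rewrite /strict_part !enum_set enum_ordSr filter_rcons setU11 map_rcons rev_rcons.
rewrite filter_map -map_comp; congr (_ :: rev (map _ _)).
by apply: eq_filter => i; rewrite /= !inE wid_neq_max mem_lift_set.
Qed.

End StrictPartitions.

(** * Truncation and divided differences *)

Section TruncationCommutes.
Variables (m n : nat) (mn : (m <= n)%N).
Implicit Types (i p : 'I_m) (f : dpoly n).

Lemma ord_prev_widen i : ord_prev (widen_ord mn i) = widen_ord mn (ord_prev i).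
Proof. exact: val_inj. Qed.

Lemma ord_widenP (P : 'I_n -> Prop) :
  (forall p, P (widen_ord mn p)) -> (forall q : 'I_n, (m <= q)%N -> P q) -> forall q, P q.
Proof.
move=> Pw Pge q; have [lt|ge] := ltnP q m; last exact: Pge.
by have -> : q = widen_ord mn (Ordinal lt) by apply: val_inj.
Qed.

Lemma sw_widen i p : sw (widen_ord mn i) (widen_ord mn p) = widen_ord mn (sw i p).
Proof.
rewrite /sw ord_prev_widen; case: (tpermP (ord_prev i) i p) => [->|->|/eqP n1 /eqP n2].
- by rewrite tpermL.
- by rewrite tpermR.
- by rewrite tpermD // (inj_eq (@widen_ord_injective _ _ mn)) eq_sym.
Qed.

Lemma sw_ge i (q : 'I_n) : (m <= q)%N -> sw (widen_ord mn i) q = q.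
Proof. by move=> mq; rewrite /sw tpermD // -val_eqE /=; have := ltn_ord i; lia. Qed.

Lemma trunc_var_widen p : trunc m ('X_(widen_ord mn p) : dpoly n) = 'X_p.
Proof.
have lt : (widen_ord mn p < m)%N := ltn_ord p.
by rewrite trunc_var zvar_lt; congr 'X_(_); apply: val_inj.
Qed.

Lemma trunc_var_ge (q : 'I_n) : (m <= q)%N -> trunc m ('X_q : dpoly n) = 0.
Proof. by move=> mq; rewrite trunc_var zvar_ge. Qed.

Lemma trunc_sroot i : trunc m (sroot {mpoly int[n]} (widen_ord mn i)) = sroot {mpoly int[m]} i.
Proof.
have [i0|i0] := eqVneq (val i) 0%N.
  by rewrite !sroot0 // rmorphM rmorph_nat /= trunc_var_widen.
by rewrite !srootS // rmorphB /= ord_prev_widen !trunc_var_widen.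
Qed.

Lemma trunc_act i f :
  trunc m (act (simple_refl (widen_ord mn i)) f) = act (simple_refl i) (trunc m f).
Proof.
pose h1 : {rmorphism dpoly n -> dpoly m} :=
  @trunc m n \o act (simple_refl (widen_ord mn i)).
pose h2 : {rmorphism dpoly n -> dpoly m} := act (simple_refl i) \o @trunc m n.
rewrite -[LHS]/(h1 f) -[RHS]/(h2 f); apply: mpoly_morph_eq => [c|] /=.
  by rewrite actC !trunc_const actC.
have [i0|i0] := eqVneq (val i) 0%N; apply: ord_widenP => [p|q mq].
- rewrite act_s0 // (inj_eq (@widen_ord_injective _ _ mn)) rmorphM rmorph_sign /= trunc_var_widen.
  by rewrite act_s0.
- rewrite act_s0 // rmorphM rmorph_sign /= trunc_var_ge // rmorph0.
  exact: mulr0.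
- by rewrite act_si // sw_widen !trunc_var_widen act_si.
- by rewrite act_si // sw_ge // trunc_var_ge // rmorph0.
Qed.

Lemma trunc_ddp i f : trunc m (ddp (widen_ord mn i) f) = ddp i (trunc m f).
Proof.
apply/esym/(ddp_unique (int_mpoly2_neq0 m)).
by rewrite -trunc_sroot -rmorphM ddpE rmorphB /= trunc_act.
Qed.

End TruncationCommutes.

(** * From [m + 1] to [m] variables *)

Section Pass.
Variable m : nat.
Local Notation R := {mpoly int[m.+1]}.
Implicit Types (f g : dpoly m.+1).

(** The divided difference for the word [s_k ... s_1 s_0]. *)
Fixpoint pass (k : nat) f : dpoly m.+1 :=
  if k is k'.+1 then ddp (inord k) (pass k' f) else ddp ord0 f.

Lemma passD k f g : pass k (f + g) = pass k f + pass k g.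
Proof.
by elim: k => [|k IH] /=; rewrite ?IH (ddpD (int_mpoly2_neq0 m.+1)).
Qed.

Lemma passM_const k f c : pass k (f * c%:MP) = pass k f * c%:MP.
Proof.
by elim: k => [|k IH] /=; rewrite ?IH (ddpM_inv (int_mpoly2_neq0 m.+1)) // actC.
Qed.

(** For [f] symmetric, the divided differences strip [e_n] of its variables one
    by one; the remaining factor is [f] modulo the last variable removed. *)
Lemma pass_top k f : (k <= m)%N ->
  (forall i : 'I_m.+1, val i != 0%N -> act (simple_refl i) f = f) ->
  exists g, pass k (mesym m.+1 R m.+1 * f) =
    (\prod_(p < m.+1 | (k < p)%N) 'X_p) * (f + 'X_(inord k) * g).
Proof.
move=> km sf; elim: k km => [|k IH] km.
  exists (- ddp ord0 f); rewrite -[pass 0 _]/(ddp ord0 _).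
  have e0 : inord 0 = ord0 :> 'I_m.+1 by apply: val_inj; rewrite /= inordK.
  rewrite e0; apply: (ddp_unique (int_mpoly2_neq0 m.+1)).
  have -> : mesym m.+1 R m.+1 = 'X_ord0 * \prod_(p < m.+1 | (0 < p)%N) 'X_p.
    rewrite mesymnnE (bigD1 ord0) //=; congr (_ * _); apply: eq_bigl => p.
    by rewrite -val_eqE /= lt0n.
  set P := \prod_(p < _ | _) _.
  have sP : act (simple_refl ord0) P = P.
    rewrite rmorph_prod; apply: eq_bigr => p p0; rewrite /= act_s0 //.
    by rewrite -val_eqE /= gtn_eqF // mul1r.
  have E := ddpE ord0 f.
  rewrite !rmorphM /= sP act_s0 // eqxx /= mulN1r.
  have -> : act (simple_refl ord0) f = f - sroot R ord0 * ddp ord0 f.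
    by rewrite E opprB addrC subrK.
  by rewrite sroot0 //; ring.
have [|g Eg] := IH; first by lia.
pose i : 'I_m.+1 := inord k.+1.
have vi : val i = k.+1 by rewrite /= inordK // ltnS.
have i0 : val i != 0%N by rewrite vi.
have ep : ord_prev i = inord k.
  by apply: val_inj; rewrite /= [nat_of_ord i]vi inordK //; lia.
exists ('X_(ord_prev i) * ddp i g); rewrite -[pass k.+1 _]/(ddp i (pass k _)) -/i Eg.
apply: (ddp_unique (int_mpoly2_neq0 m.+1)).
have -> : \prod_(p < m.+1 | (k < p)%N) 'X_p =
    'X_i * \prod_(p < m.+1 | (k.+1 < p)%N) 'X_p :> dpoly m.+1.
  rewrite (bigD1 i) /=; last by rewrite [nat_of_ord i]vi.
  congr (_ * _); apply: eq_bigl => p.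
  by rewrite -val_eqE /= [nat_of_ord i]vi; lia.
set P := \prod_(p < _ | _) _.
have sP : act (simple_refl i) P = P.
  rewrite rmorph_prod; apply: eq_bigr => p p0; rewrite /= act_si // /sw tpermD //.
    by rewrite -val_eqE /= [nat_of_ord i]vi; lia.
  by rewrite -val_eqE /= [nat_of_ord i]vi; lia.
have E := ddpE i g.
rewrite -ep !(rmorphM, rmorphD) /= sP !act_si // /sw tpermL tpermR sf //.
have -> : act (simple_refl i) g = g - sroot R i * ddp i g by rewrite E opprB addrC subrK.
by rewrite srootS //; ring.
Qed.

Lemma trunc_pass_top f :
  (forall i : 'I_m.+1, val i != 0%N -> act (simple_refl i) f = f) ->
  trunc m (pass m (mesym m.+1 R m.+1 * f)) = trunc m f.
Proof.
move=> sf; have [g ->] := pass_top (leqnn m) sf.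
rewrite big_pred0 => [|p]; last by have := ltn_ord p; lia.
by rewrite mul1r rmorphD rmorphM /= trunc_var_ge ?mul0r ?addr0 // inordK.
Qed.

(** The terms of [Qt_double m.+1] according to whether [m + 1] is a part of the
    partition indexing the factor in the [x_i] or of the complementary one,
    which indexes the factor in the [y_i]. *)
Lemma Qt_doubleS :
  let Q := \sum_(A : {set 'I_m}) Qt R m.+1 (strict_part A) *
    (Qt int m.+1 (strict_part (~: A)))%:MP : dpoly m.+1 in
  Qt_double m.+1 = mesym m.+1 R m.+1 * Q + Q * (mesym m.+1 int m.+1)%:MP.
Proof.
rewrite /= /Qt_double sum_set_ordS big_distrr big_distrl /=; congr (_ + _).
  apply: eq_bigr => A _.
  by rewrite strict_part_max Qt_cons_top lift_setUC strict_part_lift mulrA.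
apply: eq_bigr => A _; rewrite lift_setC strict_part_max Qt_cons_top strict_part_lift.
by rewrite rmorphM mulrCA mulrC.
Qed.

Lemma trunc_pass_Qt_double : trunc m (pass m (Qt_double m.+1)) = Qt_double m.
Proof.
rewrite Qt_doubleS passD passM_const rmorphD rmorphM /= trunc_const zcoef_mesym.
have e0 : mesym m int m.+1 = 0 by apply: mesym_geqnE.
rewrite e0 raddf0 mulr0 addr0 trunc_pass_top => [|i i0].
  rewrite rmorph_sum; apply: eq_bigr => A _.
  by rewrite rmorphM /= trunc_Qt trunc_const zcoef_Qt.
rewrite rmorph_sum; apply: eq_bigr => A _.
by rewrite rmorphM; congr (_ * _); [exact: act_Qt | exact: actC].
Qed.

End Pass.

(** * The embedding of [W_m] into [W_n] *)

Section Embedding.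
Variables (m n : nat) (mn : (m <= n)%N).
Implicit Types (w : signed_perm m) (p i : 'I_m).

Lemma sval_embed_lt w p : sval (embed mn w) (widen_ord mn p) = sval w p.
Proof.
rewrite /sval /= permE ffunE /embed_abs.
by case: insubP => [j _ ej|]; [rewrite (val_inj ej : j = p) | move=> /= /negP[]; apply: ltn_ord].
Qed.

Lemma sval_embed_ge w (q : 'I_n) : (m <= q)%N -> sval (embed mn w) q = q.+1%:Z.
Proof.
by move=> mq; rewrite /sval /= permE ffunE /embed_abs insubF ?mul1r // ltnNge mq.
Qed.

Lemma embedM w i :
  embed mn (w * simple_refl i)%g = (embed mn w * simple_refl (widen_ord mn i))%g.
Proof.
apply: sval_inj => q; move: q.
have [i0|i0] := eqVneq (val i) 0%N; apply: (ord_widenP (mn := mn)) => [p|q mq].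
- by rewrite sval_embed_lt !sval_s0 // (inj_eq (@widen_ord_injective _ _ mn)) sval_embed_lt.
- rewrite sval_s0 // !sval_embed_ge //.
  have -> : (q == widen_ord mn i) = false by rewrite -val_eqE /=; have := ltn_ord i; lia.
  by rewrite mul1r.
- by rewrite sval_embed_lt !sval_si // sw_widen sval_embed_lt.
- by rewrite sval_si // sw_ge // !sval_embed_ge.
Qed.

Lemma rdesc_embed w i : rdesc (widen_ord mn i) (embed mn w) = rdesc i w.
Proof. by rewrite /rdesc /= ord_prev_widen !sval_embed_lt. Qed.

End Embedding.

Lemma embed_comp m k n (mk : (m <= k)%N) (kn : (k <= n)%N) (mn : (m <= n)%N)
    (w : signed_perm m) : embed kn (embed mk w) = embed mn w.
Proof.
apply: sval_inj => q; move: q; apply: (ord_widenP (mn := mn)) => [p|q mq].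
  have -> : widen_ord mn p = widen_ord kn (widen_ord mk p) by apply: val_inj.
  rewrite sval_embed_lt sval_embed_lt.
  have -> : widen_ord kn (widen_ord mk p) = widen_ord mn p by apply: val_inj.
  by rewrite sval_embed_lt.
rewrite [RHS]sval_embed_ge //; have [qk|kq] := ltnP q k; last exact: sval_embed_ge.
have -> : q = widen_ord kn (Ordinal qk) by apply: val_inj.
by rewrite sval_embed_lt sval_embed_ge.
Qed.

Section ChainToSmallerRho.
Variable m : nat.

(** The entries after [k] steps of the chain from [w_rho m.+1] down to the image
    of [w_rho m]: the letter [m.+1] becomes positive and moves to position [k]. *)
Definition pass_val (k p : nat) : int :=
  if (p < k)%N then - (m - p)%N%:Z
  else if p == k then m.+1%:Z else - (m.+1 - p)%N%:Z.

Lemma pass_chain k : (k <= m)%N ->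
  exists w : signed_perm m.+1, (forall p : 'I_m.+1, sval w p = pass_val k p) /\
    schubertC w = pass k (Qt_double m.+1).
Proof.
elim: k => [|k IH] km.
  exists (w_rho m.+1 * simple_refl ord0)%g; split=> [p|].
    rewrite sval_s0 // sval_w_rho /pass_val -val_eqE /=.
    by case: eqP => [->|_] /=; rewrite ?expr1 ?mulN1r ?mul1r; lia.
  rewrite schubertC_desc ?schubertC_rho //.
  by rewrite /rdesc /= sval_w_rho /=; lia.
have [|w [wE Cw]] := IH; first by lia.
pose i : 'I_m.+1 := inord k.+1.
have vi : nat_of_ord i = k.+1 by rewrite inordK // ltnS.
have i0 : val i != 0%N by rewrite /= vi.
have di : rdesc i w.
  rewrite /rdesc (negPf i0) !wE /pass_val /= vi /=.
  by rewrite eqxx ltnn; do ?case: ifP; lia.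
exists (w * simple_refl i)%g; split=> [p|].
  rewrite sval_si // wE /sw /pass_val.
  case: tpermP => [->|->|/eqP + /eqP] /=; rewrite -?val_eqE /= vi /=;
    case: (ltngtP p k) => ?; do ?case: ifP; try lia.
by rewrite (schubertC_desc di) Cw.
Qed.

Lemma schubertC_embed_rho :
  schubertC (embed (leqnSn m) (w_rho m)) = pass m (Qt_double m.+1).
Proof.
have [w [wE <-]] := pass_chain (leqnn m); congr schubertC.
apply: sval_inj => q; move: q; apply: (ord_widenP (mn := leqnSn m)) => [p|q mq].
  by rewrite sval_embed_lt sval_w_rho wE /pass_val /= ltn_ord.
by rewrite sval_embed_ge // wE /pass_val; have := ltn_ord q; do ?case: ifP; lia.
Qed.

End ChainToSmallerRho.

(** * Elements below [w_rho] in the weak order *)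

Section Shuffles.
Variable n : nat.
Implicit Types (w u v : signed_perm n) (i p q : 'I_n) (a : seq 'I_n).

(** [w] is a shuffle of [-r, ..., -1] and [r+1, ..., n] for some [r]: entries of
    the same sign increase, and the barred letters are smaller than the others. *)
Definition shuffle w : Prop :=
  (forall p q, (p < q)%N -> (0 < sval w p) = (0 < sval w q) -> sval w p < sval w q) /\
  (forall p q, sval w p < 0 -> 0 < sval w q -> - sval w p < sval w q).

Lemma shuffle_swap w i : val i != 0%N -> shuffle w ->
  (0 < sval w (ord_prev i)) != (0 < sval w i) -> shuffle (w * simple_refl i)%g.
Proof.
move=> i0 [S1 S2] ne; split=> p q; rewrite !sval_si //; last exact: S2.
rewrite /sw; case: tpermP => [->|->|/eqP + /eqP]; rewrite -?val_eqE /=;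
  case: tpermP => [->|->|/eqP + /eqP]; rewrite -?val_eqE /=; move: i0 => /= *.
all: try (by apply: S1 => //=; lia); try (by lia).
all: by move: ne; match goal with H : _ = _ |- _ => rewrite H eqxx end.
Qed.

Lemma shuffle_bar w i : val i = 0%N -> shuffle w -> shuffle (w * simple_refl i)%g.
Proof.
move=> i0 [S1 S2].
have lt p : p != i -> (i < p)%N by rewrite -val_eqE /=; move: i0 => /=; lia.
split=> p q; rewrite !sval_s0 //; have := sval_neq0 w i;
  have [->|np] := eqVneq p i; have [->|nq] := eqVneq q i;
  rewrite ?expr1 ?expr0 ?mulN1r ?mul1r => w0.
- by rewrite ltnn.
- by have := S1 _ _ (lt _ nq); have := S2 i q; have := S2 q i; have := sval_neq0 w q; lia.
- by have := lt _ np; lia.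
- exact: S1.
- by lia.
- by have := S1 _ _ (lt _ nq); have := S2 i q; have := S2 q i; have := sval_neq0 w q; lia.
- by have := S1 _ _ (lt _ np); have := S2 i p; have := S2 p i; have := sval_neq0 w p; lia.
- exact: S2.
Qed.

(** At a descent the two entries have opposite signs. *)
Lemma shuffle_desc w i : shuffle w -> rdesc i w -> shuffle (w * simple_refl i)%g.
Proof.
move=> Sw; have [i0|i0] := eqVneq (val i) 0%N; first by move=> _; apply: shuffle_bar.
rewrite /rdesc (negPf i0) => d; apply: shuffle_swap => //.
apply/eqP => e; have := Sw.1 (ord_prev i) i _ e; move: i0 => /= i0.
by have -> : (i.-1 < i)%N by [lia]; move/(_ isT); lia.
Qed.

Lemma shuffle_weak_le u v : weak_le u v -> shuffle v -> shuffle u.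
Proof.
move=> [a [-> L]]; elim/last_ind: a L => [|a i IH].
  by rewrite /word big_nil mulg1.
rewrite size_rcons word_rcons mulgA => L Sv; apply: IH; last first.
  have <- : (u * word a * simple_refl i * simple_refl i = u * word a)%g.
    by rewrite -mulgA simple_reflK mulg1.
  apply: shuffle_desc Sv _.
  apply: contraLR (sp_length_word_le u a) => nd.
  have := sp_length_mul (u * word a)%g i; move: nd; rewrite rdesc_mul negbK => ->.
  by rewrite addn1 addn0 -L -ltnNge => <-; rewrite addnS; lia.
have := sp_length_mul (u * word a)%g i; have := sp_length_word_le u a.
by rewrite -L; case: rdesc => /=; rewrite !(addn0, addn1, addnS); lia.
Qed.

Lemma rho_of_neg w : shuffle w -> (forall p, sval w p < 0) -> (w * w_rho n = 1)%g.
Proof.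
move=> Sw wn; apply: rdesc_none => i.
have E p : sval (w * w_rho n)%g p = - sval w (rev_ord p).
  by rewrite svalM /= ffunE permE mulN1r.
rewrite /rdesc !E; case: eqP => [_|/eqP i0]; first by have := wn (rev_ord i); lia.
have lt : (rev_ord i < rev_ord (ord_prev i))%N.
  by move: i0; have := ltn_ord i; rewrite /=; lia.
have := Sw.1 _ _ lt; have := wn (rev_ord i); have := wn (rev_ord (ord_prev i)); lia.
Qed.

Lemma shuffle_rho : shuffle (w_rho n).
Proof.
by split=> p q; rewrite !sval_w_rho; have := ltn_ord p; have := ltn_ord q; lia.
Qed.

(** [w_rho n] is the only shuffle without positive entries, since both it and any
    such [w] are inverse to [w_rho n]. *)
Lemma shuffle_neg w : shuffle w -> (forall p, sval w p < 0) -> w = w_rho n.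
Proof.
move=> Sw wn; apply: (mulIg (w_rho n)); rewrite rho_of_neg // rho_of_neg //.
  exact: shuffle_rho.
by move=> p; rewrite sval_w_rho; have := ltn_ord p; lia.
Qed.

(** A shuffle other than [w_rho n] lies below a shuffle of larger length: its first
    positive entry is barred if it is in the first position, and otherwise
    exchanged with the negative entry before it. *)
Lemma shuffle_up w : shuffle w ->
  w = w_rho n \/ exists i, ~~ rdesc i w /\ shuffle (w * simple_refl i)%g.
Proof.
move=> Sw; have [/existsP[p0 p0P]|/existsPn nP] := boolP [exists p, 0 < sval w p]; last first.
  by left; apply: shuffle_neg => // p; have := nP p; have := sval_neq0 w p; lia.
right; case: (@arg_minnP _ p0 (fun p => 0 < sval w p) (@nat_of_ord n) p0P) => i iP imin.
exists i; have [i0|i0] := eqVneq (val i) 0%N.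
  by split; [rewrite /rdesc i0 eqxx; lia | apply: shuffle_bar].
have pn : sval w (ord_prev i) < 0.
  have := imin (ord_prev i); have := sval_neq0 w (ord_prev i); move: i0 => /= i0.
  by case: ltrP => //; lia.
by split; [rewrite /rdesc (negPf i0); lia | apply: shuffle_swap => //; lia].
Qed.

End Shuffles.

Lemma shuffle_embed m n (mn : (m <= n)%N) (w : signed_perm m) :
  shuffle (embed mn w) <-> shuffle w.
Proof.
split=> [[S1 S2]|[S1 S2]]; split=> p q.
- by have := S1 (widen_ord mn p) (widen_ord mn q); rewrite !sval_embed_lt.
- by have := S2 (widen_ord mn p) (widen_ord mn q); rewrite !sval_embed_lt.
- move: p; elim/(@ord_widenP _ _ mn): q => [q|q mq]; apply: (ord_widenP (mn := mn)) => [p|p mp].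
  + by rewrite !sval_embed_lt; apply: S1.
  + by move=> /= pq; have := ltn_ord q; lia.
  + by rewrite sval_embed_lt sval_embed_ge //; have := sval_le w p; lia.
  + by rewrite !sval_embed_ge //; lia.
- move: p; elim/(@ord_widenP _ _ mn): q => [q|q mq]; apply: (ord_widenP (mn := mn)) => [p|p mp].
  + by rewrite !sval_embed_lt; apply: S2.
  + by rewrite sval_embed_ge.
  + by rewrite sval_embed_lt sval_embed_ge //; have := sval_le w p; lia.
  + by rewrite !sval_embed_ge //; lia.
Qed.

(** * Stability *)

(** Stability from [m + 1] to [m] variables: both sides agree at [w_rho m], and
    divided differences commute with the truncation. *)
Lemma schubertC_stableS m (w : signed_perm m) : shuffle w ->
  trunc m (schubertC (embed (leqnSn m) w)) = schubertC w.
Proof.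
pose M := (\max_(u : signed_perm m) sp_length u)%N.
(* Induction on the difference with the largest length in [W_m]. *)
move Ed: (M - sp_length w)%N => d; elim: d w Ed => [|d IH] w Ed Sw.
all: have [->|[i [nd Su]]] := shuffle_up Sw;
  first by rewrite schubertC_embed_rho trunc_pass_Qt_double schubertC_rho.
all: have Lu := sp_length_mul w i; rewrite (negPf nd) /= addn0 addn1 in Lu.
all: have Mu : (sp_length (w * simple_refl i)%g <= M)%N by apply: leq_bigmax.
  by lia.
have du : rdesc i (w * simple_refl i)%g by rewrite rdesc_mul.
have wE : w = (w * simple_refl i * simple_refl i)%g by rewrite -mulgA simple_reflK mulg1.
rewrite {1}wE embedM schubertC_desc ?rdesc_embed // trunc_ddp IH //; last by lia.
by rewrite -(schubertC_desc du) -wE.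
Qed.

Lemma schubertC_stable m n (mn : (m < n)%N) (w : signed_perm m) : shuffle w ->
  trunc m (schubertC (embed (ltnW mn) w)) = schubertC w.
Proof.
move=> Sw; elim: n mn => [//|n IH] mn.
have [lt|ge] := ltnP m n; last first.
  have em : n = m by lia.
  subst n; rewrite (bool_irrelevance (ltnW mn) (leqnSn m)).
  exact: schubertC_stableS.
have Se : shuffle (embed (ltnW lt) w) by apply/shuffle_embed.
rewrite -(embed_comp (ltnW lt) (leqnSn n)) -(trunc_comp (ltnW lt)).
by rewrite (schubertC_stableS Se) IH.
Qed.

Lemma weak_le_oo_shuffle m k (w : signed_perm m) : weak_le_oo w (w_rho k) -> shuffle w.
Proof.
move=> [N [mN [kN le]]]; apply/(shuffle_embed mN)/(shuffle_weak_le le)/shuffle_embed.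
exact: shuffle_rho.
Qed.

Theorem proposition2 (m : nat) (w : signed_perm m) (k : nat) (k_gt0 : (0 < k)%N)
    (w_le_rho : weak_le_oo w (w_rho k)) (n : nat) (m_lt_n : (m < n)%N) :
  trunc_vars m (schubertC (embed (ltnW m_lt_n) w)) = schubertC w.
Proof.
have := schubertC_stable m_lt_n (weak_le_oo_shuffle w_le_rho).
by rewrite trunc.unlock.
Qed.
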